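(* Suppose $n\to\infty$ and $m=m(n)\to\infty$ in such a way that $n/m\to\alpha\in(0,\infty)$. For each $n$, let $X_1,\dots,X_n$ be independent random variables uniformly distributed on $[m]=\{1,\dots,m\}$ (the uniform case), and let $Y=Y(n)$ be the number of non-isolated balls. Let $$g(\alpha):=\left(e^{-\alpha}-e^{-2\alpha}(\alpha^2-\alpha+1)\right)^{1/2}.$$ Then $g(\alpha)>0$ and $$\limsup_{n\to\infty}n^{1/2}D_Y\le\frac{0.8}{g(\alpha)}+256\left(\frac{1-e^{-\alpha}}{g(\alpha)^3}\right)+92\left(\frac{1-e^{-\alpha}}{g(\alpha)^2}\right)\left(1+3\alpha(1+\alpha)\right)^{1/2}.$$
   Context: For $1\le i\le n$ let $M_i:=-1+\sum_{j=1}^n\mathbf{1}\{X_j=X_i\}$ (the number of other balls in the same urn as ball $i$). The number of non-isolated balls is $Y:=\sum_{i=1}^n\mathbf{1}\{M_i>0\}$. For a random variable $W$ with finite mean $\mu_W$ and standard deviation $\sigma_W\in(0,\infty)$, $D_W:=\sup_{t\in\mathbb{R}}\left|P\left[\frac{W-\mu_W}{\sigma_W}\le t\right]-\Phi(t)\right|$, where $\Phi$ is the standard normal distribution function. It is assumed throughout that $m\ge 4$. *)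

(* Defs.v *)
From HB Require Import structures.
From mathcomp Require Import all_boot all_order all_algebra.
From mathcomp Require Import all_classical all_reals all_analysis.

Set Implicit Arguments.
Unset Strict Implicit.
Unset Printing Implicit Defensive.

Import Order.TTheory GRing.Theory Num.Theory.
Import numFieldNormedType.Exports.

Local Open Scope classical_set_scope.
Local Open Scope ring_scope.

Definition mutually_independent d d' (T : measurableType d)
    (T' : measurableType d') (R : realType) (P : probability T R)
    (I : finType) (X : I -> {RV P >-> T'}) : Prop :=
  forall (J : {set I}) (A : I -> set T'), (forall i, measurable (A i)) ->
    P (\bigcap_(i in [set` J]) (X i @^-1` A i))
    = (\prod_(i in J) P (X i @^-1` A i))%E.

(* The law of X is then determined: the m values 1, ..., m exhaust the mass. *)
Definition uniform_on_range d (T : measurableType d) (R : realType)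
    (P : probability T R) (m : nat) (X : {RV P >-> nat}) : Prop :=
  forall k, (1 <= k <= m)%N -> distribution P X [set k] = (m%:R^-1)%:E.

(* Total; it has its intended meaning when the variance of W is in ]0, +oo[
   (x / 0 = 0 otherwise). *)
Definition kolmogorov_normal d (T : measurableType d) (R : realType)
    (P : probability T R) (W : {RV P >-> R}) : R :=
  let mu := fine 'E_P[W] in
  let sigma := Num.sqrt (fine 'V_P[W]) in
  sup [set `|fine (P [set w | (W w - mu) / sigma <= t])
             - fine (normal_prob 0 1 `]-oo, t])| | t in [set: R]].

Arguments kolmogorov_normal {d T R} P W.

Section Occupancy.
Context d (T : measurableType d) (R : realType) (P : probability T R).
Variables (n : nat) (X : 'I_n -> {RV P >-> nat}).

(* The sum counts j = i, so the predecessor is a genuine subtraction of 1. *)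
Definition urn_mates (i : 'I_n) (w : T) : nat :=
  (\sum_(j < n) (X j w == X i w)).-1.

Definition non_isolated (w : T) : R :=
  (\sum_(i < n) (0 < urn_mates i w))%:R.

Lemma measurable_non_isolated : measurable_fun setT non_isolated.
Proof.
move=> _ B _; rewrite setTI.
pose Z w : {ffun 'I_n -> nat} := [ffun i => X i w].
pose F (z : {ffun 'I_n -> nat}) : R :=
  (\sum_(i < n) (0 < (\sum_(j < n) (z j == z i)).-1))%:R.
have FZ w : non_isolated w = F (Z w).
  rewrite /non_isolated /F /urn_mates; congr (_%:R).
  by apply: eq_bigr => i _; under [in RHS]eq_bigr do rewrite !ffunE.
have -> : non_isolated @^-1` B = \bigcup_(z : {ffun 'I_n -> nat})
    (if `[< B (F z) >] then \bigcap_(i in [set: 'I_n]) (X i @^-1` [set z i])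
     else set0).
  apply/seteqP; split=> [w /= Bw|w [z _]].
    exists (Z w) => //; rewrite asboolT -?FZ// => i _ /=.
    by rewrite ffunE.
  case: asboolP => // Bz zw /=; rewrite FZ.
  by have -> : Z w = z by apply/ffunP => i; rewrite ffunE; exact: zw.
apply: countable_bigcupT_measurable => [|z]; first exact: countableP.
case: ifP => // _; apply: fin_bigcap_measurable => [|i _].
  exact: finite_finset.
by rewrite -[X in measurable X]setTI; exact: measurable_funPT.
Qed.

HB.instance Definition _ :=
  isMeasurableFun.Build _ _ _ _ non_isolated measurable_non_isolated.

End Occupancy.

Definition g (R : realType) (a : R) : R :=
  Num.sqrt (expR (- a) - expR (- 2 * a) * (a ^+ 2 - a + 1)).

(* Main.v *)
(* Stein's method on the finite space of all configurations x : [n] -> [m].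
   For an urn u, throwing a random ball into u turns the binomial Stein operator
   of the occupation number c_u into a sum of increments: for every e,
     sum_j E[e(c_u) (F(x^{j->u}) - F(x))]
       = E[((m-1) c_u e(c_u - 1) - (n - c_u) e(c_u)) F(x)].
   Solving the recursion so that the right-hand side, summed over u, becomes
   E[(Y - E Y) F] yields weights 0 <= e <= (1 - b)/(n - 1), where b is the
   probability that a given ball is isolated. Each move changes Y by at most 2,
   and the sum S of the weighted increments of Y is a function of the occupation
   numbers with bounded differences of order 1 - b, so E S = Var Y and
   Var S = O(n (1 - b)^2). Stein's equation for a piecewise linear approximation
   of an indicator, with the smoothing width chosen so that the Kolmogorov
   distance D reappears on the right only as D/2, then bounds D by a multiple
   of n (1 - b) (Var Y)^(-3/2) + n^(1/2) (1 - b) / Var Y, with constants below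
   those of the theorem. *)

Require Import Defs.
From mathcomp Require Import all_boot all_order all_algebra.
From mathcomp Require Import all_classical all_reals all_analysis.
From mathcomp Require Import measurable_realfun ring lra.
Import Order.TTheory GRing.Theory Num.Theory.
Import numFieldNormedType.Exports.
Local Open Scope classical_set_scope.
Local Open Scope ring_scope.
Set Implicit Arguments.
Unset Strict Implicit.
Unset Printing Implicit Defensive.

(** * The normal law and its Stein equation *)

Section StandardNormal.
Variable R : realType.
Implicit Types (h : R -> R) (w x : R).
Let mu := @lebesgue_measure R.

Let phi : R -> R := normal_pdf 0 1.
Definition std_cdf w : R := fine (normal_prob 0 1 `]-oo, w]).

Lemma std_pdfE w : normal_pdf 0 1 w = normal_peak 1 * expR (- (w ^+ 2 / 2)).
Proof.
rewrite normal_pdfE ?oner_neq0// /normal_fun subr0 expr1n.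
by rewrite mulNr.
Qed.

Lemma std_pdf_gt0 w : 0 < normal_pdf 0 1 w.
Proof. by rewrite std_pdfE mulr_gt0 ?expR_gt0// normal_peak_gt0// oner_neq0. Qed.

Lemma std_pdfN w : normal_pdf 0 1 (- w) = normal_pdf 0 1 w.
Proof. by rewrite !std_pdfE sqrrN. Qed.

Lemma is_derive_std_pdf w : is_derive w 1 (normal_pdf 0 1) (- (w * normal_pdf 0 1 w)).
Proof.
have -> : normal_pdf 0 1 = (fun w => normal_peak 1 * expR (- (w ^+ 2 / 2))) :> (R -> R).
  by apply/funext => x; exact: std_pdfE.
apply: is_derive_eq.
rewrite /GRing.scale/=.
by field.
Qed.

Lemma std_peak_le1 : normal_peak 1 <= 1 :> R.
Proof.
have p2 := @pi_ge2 R.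
rewrite invf_le1 ?sqrtr_gt0; last by rewrite expr1n mul1r mulrn_wgt0// pi_gt0.
rewrite -[leLHS]sqrtr1 ler_sqrt expr1n mul1r; last by rewrite mulrn_wge0// pi_ge0.
by rewrite -mulr_natr; lra.
Qed.

(** The peak is at least 1/3 because 2 pi < 9, and exp(- w^2 / 2) >= 1 - w^2 / 2 >= 1/2. *)
Lemma std_pdf_ge w : `|w| <= 1 -> 6^-1 <= normal_pdf 0 1 w.
Proof.
move=> w1; rewrite std_pdfE.
have w2 : w ^+ 2 <= 1 by rewrite -real_normK ?num_real// expr_le1.
have e1 : 2^-1 <= expR (- (w ^+ 2 / 2)).
  by apply: le_trans (expR_ge1Dx _); lra.
have pk : 3^-1 <= normal_peak 1 :> R.
  have /andP[_ p2] := @pihalf_02 R.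
  have p0 : 0 < pi *+ 2 :> R by rewrite mulrn_wgt0// pi_gt0.
  rewrite /normal_peak expr1n mul1r lef_pV2 ?posrE ?sqrtr_gt0//.
  rewrite -[leRHS]gtr0_norm// -sqrtr_sqr ler_sqrt ?sqr_ge0//.
  by rewrite -mulr_natr expr2; lra.
apply: le_trans (ler_pM _ _ pk e1); lra.
Qed.

Section Cutoff.
Variable h : R -> R.
Hypothesis ch : continuous h.
Hypothesis h01 : forall x, 0 <= h x <= 1.

Lemma integrable_mul_std_pdf (A : set R) : measurable A ->
  mu.-integrable A (EFin \o (fun x => h x * phi x)).
Proof.
move=> mA; apply: (@le_integrable _ _ _ mu _ mA _ (EFin \o phi)).
- apply/measurable_EFinP; apply: measurable_funTS.
  apply: measurable_funM; last exact: measurable_normal_pdf.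
  exact: continuous_measurable_fun.
- move=> x _; rewrite /= lee_fin normrM ler_piMl//.
  by have /andP[h0 h1] := h01 x; rewrite ger0_norm.
- by apply: integrableS (integrable_normal_pdf 0 1).
Qed.

(** The expectation of h(Z) for Z standard normal; [cut_cdf w] is the part of it carried by Z <= w,
    so that h = 1 recovers the normal distribution function. *)
Definition cut_mean : R := \int[mu]_x (h x * phi x).
Definition cut_cdf w : R := \int[mu]_(x in `]-oo, w]) (h x * phi x).

Lemma is_derive_cut_cdf w : is_derive w 1 cut_cdf (h w * phi w).
Proof.
have [||||d1 d2] := @continuous_FTC1 R (fun x => h x * phi x) -oo%O w (w + 1).
- by rewrite ltrDl.
- by apply: integrable_mul_std_pdf.
- exact: ltNyr.
- by apply: cvgM; [exact: ch|apply: continuous_normal_pdf; exact: oner_neq0].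
by apply: DeriveDef; [exact: d1|rewrite -derive1E; exact: d2].
Qed.

Lemma cut_meanE w : cut_mean = cut_cdf w + \int[mu]_(x in `]w, +oo[) (h x * phi x).
Proof.
rewrite /cut_mean -Rintegral_setU//=.
- by congr Rintegral; rewrite -set_itvE -(@itv_bndbnd_setU _ _ _ (BRight w))//.
- exact: integrable_mul_std_pdf (measurableU _ _ _ _).
- apply/disj_setPS => x []/=; rewrite !in_itv/= andbT => xw wx.
  by rewrite ltNge xw in wx.
Qed.

Lemma cut_cdf_ge0 w : 0 <= cut_cdf w.
Proof.
apply: Rintegral_ge0 => x _.
by rewrite mulr_ge0 ?normal_pdf_ge0//; case/andP: (h01 x).
Qed.

Lemma cut_cdf_le_mean w : cut_cdf w <= cut_mean.
Proof.
rewrite (cut_meanE w) lerDl; apply: Rintegral_ge0 => x _.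
by rewrite mulr_ge0 ?normal_pdf_ge0//; case/andP: (h01 x).
Qed.

End Cutoff.

Let c1 : continuous (fun _ : R => 1 : R).
Proof. by move=> x; apply: cvg_cst. Qed.
Let b1 (x : R) : 0 <= (1 : R) <= 1.
Proof. by rewrite ler01 lexx. Qed.

Lemma std_cdfE w : std_cdf w = cut_cdf (fun=> 1) w.
Proof.
rewrite /cut_cdf; under eq_Rintegral do rewrite mul1r.
by [].
Qed.

Lemma cut_mean1 : cut_mean (fun=> 1) = 1.
Proof.
rewrite /cut_mean; under eq_Rintegral do rewrite mul1r.
by rewrite /Rintegral integral_normal_pdf.
Qed.

Lemma std_cdf_ge0 w : 0 <= std_cdf w.
Proof. by rewrite std_cdfE cut_cdf_ge0. Qed.

Lemma std_cdf_le1 w : std_cdf w <= 1.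
Proof. by have := cut_cdf_le_mean c1 b1 w; rewrite -std_cdfE cut_mean1. Qed.

Lemma is_derive_std_cdf w : is_derive w 1 std_cdf (phi w).
Proof.
have -> : std_cdf = cut_cdf (fun=> 1) by apply/funext => x; exact: std_cdfE.
by rewrite -[phi w]mul1r; apply: is_derive_cut_cdf.
Qed.

Lemma std_cdf_upper w : 1 - std_cdf w = \int[mu]_(x in `]w, +oo[) phi x.
Proof.
rewrite -[X in X - _]cut_mean1 (@cut_meanE _ c1 b1 w) -std_cdfE addrAC subrr add0r.
by under eq_Rintegral do rewrite mul1r.
Qed.

Section CutoffBounds.
Variable h : R -> R.
Hypothesis ch : continuous h.
Hypothesis h01 : forall x, 0 <= h x <= 1.

Lemma cut_cdf_le_std w : cut_cdf h w <= std_cdf w.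
Proof.
rewrite std_cdfE; apply: le_Rintegral => //; try exact: integrable_mul_std_pdf.
move=> x _; rewrite ler_wpM2r ?normal_pdf_ge0//.
by case/andP: (h01 x).
Qed.

Lemma cut_tail_le_std w : cut_mean h - cut_cdf h w <= 1 - std_cdf w.
Proof.
rewrite (@cut_meanE _ ch h01 w) addrAC subrr add0r std_cdf_upper.
have -> : \int[mu]_(x in `]w, +oo[) phi x = \int[mu]_(x in `]w, +oo[) (1 * phi x).
  by under [RHS]eq_Rintegral do rewrite mul1r.
apply: le_Rintegral => //; try exact: integrable_mul_std_pdf.
move=> x _; rewrite ler_wpM2r ?normal_pdf_ge0//.
by case/andP: (h01 x).
Qed.

Lemma cut_mean01 : 0 <= cut_mean h <= 1.
Proof.
apply/andP; split; first exact: le_trans (cut_cdf_ge0 h01 0) (cut_cdf_le_mean ch h01 0).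
have := cut_tail_le_std 0; have := cut_cdf_le_std 0; lra.
Qed.

Lemma cut_mean_le_std b : (forall x, b < x -> h x = 0) -> cut_mean h <= std_cdf b.
Proof.
move=> hb; rewrite (@cut_meanE _ ch h01 b).
have -> : \int[mu]_(x in `]b, +oo[) (h x * phi x) = \int[mu]_(x in `]b, +oo[) 0.
  apply: eq_Rintegral => x; rewrite inE/= in_itv/= andbT => bx.
  by rewrite hb ?mul0r.
rewrite Rintegral_cst// mul0r addr0.
exact: cut_cdf_le_std.
Qed.

Lemma std_le_cut_mean a : (forall x, x <= a -> h x = 1) -> std_cdf a <= cut_mean h.
Proof.
move=> ha; apply: le_trans (cut_cdf_le_mean ch h01 a).
rewrite std_cdfE le_eqVlt; apply/orP; left; apply/eqP/eq_Rintegral.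
by move=> x; rewrite inE/= in_itv/= => bx; rewrite ha.
Qed.

End CutoffBounds.

(** Mean value theorem; the density never exceeds its peak, which is at most 1. *)
Lemma std_cdf_lip a b : a <= b -> 0 <= std_cdf b - std_cdf a <= b - a.
Proof.
move=> ab.
have [|c _ ->] := @MVT_segment R std_cdf phi a b ab (fun x _ => is_derive_std_cdf x).
  apply: derivable_within_continuous => x _; exact: (@ex_derive _ _ _ _ _ _ _ (is_derive_std_cdf x)).
rewrite mulr_ge0 ?normal_pdf_ge0 ?subr_ge0//=.
rewrite ler_piMl ?subr_ge0//.
exact: le_trans (normal_pdf_ub _ _ (oner_neq0 _)) std_peak_le1.
Qed.

Lemma std_pdf_cvgy : normal_pdf 0 1 x @[x --> +oo] --> (0 : R).
Proof.
have e0 : (fun x => normal_peak 1 * expR (- x)) x @[x --> +oo] --> (0 : R).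
  by rewrite -(mulr0 (normal_peak 1)); apply: cvgM; [exact: cvg_cst|exact: cvgr_expR].
apply: (squeeze_cvgr _ (cvg_cst 0) e0).
near=> x; rewrite normal_pdf_ge0 std_pdfE/= ler_wpM2l ?normal_peak_ge0//.
have x2 : 2 <= x by near: x; apply: nbhs_pinfty_ge; rewrite num_real.
by rewrite ler_expR lerN2; nra.
Unshelve. all: by end_near. Qed.

(** Mills' inequality: on [w, +oo[ the factor w is at most x, and x phi(x) has the antiderivative -
    phi(x), which vanishes at infinity. *)
Lemma std_cdf_tail w : 0 <= w -> w * (1 - std_cdf w) <= normal_pdf 0 1 w.
Proof.
move=> w0; rewrite std_cdf_upper -RintegralZl//; last first.
  by apply: integrableS (integrable_normal_pdf 0 1).
rewrite Rintegral_itv_obnd_cbnd; last first.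
  apply: (@integrableZl _ _ _ mu _ _ w (EFin \o phi)) => //.
  by apply: integrableS (integrable_normal_pdf 0 1).
have FTC : (\int[mu]_(x in `[w, +oo[) (x * phi x)%:E = 0%:E - (- phi w)%:E)%E.
  have cphi : continuous phi by apply: continuous_normal_pdf; exact: oner_neq0.
  have dphi x : is_derive x 1 (fun y => - phi y) (x * phi x).
    by rewrite -[x * _]opprK; apply: is_deriveN; exact: is_derive_std_pdf.
  apply: (@ge0_continuous_FTC2y R (fun x => x * phi x) (fun x => - phi x)).
  - by move=> x wx; rewrite mulr_ge0 ?normal_pdf_ge0// (le_trans w0).
  - by apply: continuous_subspaceT => x; apply: cvgM => //; exact: cphi.
  - by rewrite -oppr0; apply: cvgN; exact: std_pdf_cvgy.
  - by move=> x _; exact: (@ex_derive _ _ _ _ _ _ _ (dphi x)).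
  - by apply: cvgN; apply: cvg_at_right_filter; exact: cphi.
  - by move=> x _; rewrite derive1E; exact: (@derive_val _ _ _ _ _ _ _ (dphi x)).
rewrite sub0e EFinN oppeK in FTC.
rewrite -lee_fin -FTC /Rintegral fineK; last first.
  apply: integrable_fin_num => //.
  apply: (@integrableZl _ _ _ mu _ _ w (EFin \o phi)) => //.
  by apply: integrableS (integrable_normal_pdf 0 1).
apply: ge0_le_integral => //.
- by move=> x _; rewrite lee_fin mulr_ge0 ?normal_pdf_ge0.
- apply/measurable_EFinP; apply: measurable_funTS; apply: measurable_funM => //.
  exact: measurable_normal_pdf.
- apply/measurable_EFinP; apply: measurable_funTS; apply: measurable_funM => //.
  exact: measurable_normal_pdf.
- move=> x/=; rewrite in_itv/= andbT => wx.
  by rewrite lee_fin ler_wpM2r ?normal_pdf_ge0.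
Qed.

Lemma std_cdfN w : std_cdf (- w) = 1 - std_cdf w.
Proof.
rewrite std_cdf_upper Rintegral_itv_obnd_cbnd; last first.
  by apply: integrableS (integrable_normal_pdf 0 1).
rewrite /std_cdf /normal_prob /Rintegral.
have -> := @ge0_integration_by_substitutionNy R phi w.
- by have -> : phi \o -%R = phi by apply/funext => x; exact: std_pdfN.
- by apply: continuous_subspaceT; apply: continuous_normal_pdf; exact: oner_neq0.
- by move=> x _; exact: normal_pdf_ge0.
Qed.

(** On [0, 1] the density is at least 1/6 and the tail at most 1; beyond 1 Mills' inequality already
    gives the factor 1. *)
Lemma std_cdf_tail_pdf w : 0 <= w -> 1 - std_cdf w <= 6 * normal_pdf 0 1 w.
Proof.
move=> w0; have [w1|w1] := leP w 1.
  have := @std_pdf_ge w; rewrite ger0_norm// => /(_ w1).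
  have := std_cdf_ge0 w; lra.
have := std_cdf_tail w0; have := std_cdf_le1 w; have := std_pdf_gt0 w.
nra.
Qed.

(** The reflection w -> - w exchanges the two hypotheses, so w >= 0 may be assumed. Applied to the
    numerator of the Stein solution f, this bounds both f(w) and w f(w). *)
Lemma std_tail_bounds w (a : R) : `|a| <= std_cdf w -> `|a| <= 1 - std_cdf w ->
  `|a| <= 6 * normal_pdf 0 1 w /\ `|w| * `|a| <= normal_pdf 0 1 w.
Proof.
wlog w0 : w / 0 <= w.
  move=> H aw aw'; have [w0|w0] := leP 0 w; first exact: H.
  rewrite -std_pdfN -[`|w|]normrN; apply: H; first by rewrite oppr_ge0 ltW.
    by rewrite std_cdfN.
  by rewrite std_cdfN opprB addrC subrK.
move=> _ aw; split; first exact: le_trans aw (std_cdf_tail_pdf w0).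
by rewrite ger0_norm//; apply: le_trans (std_cdf_tail w0); rewrite ler_wpM2l.
Qed.

(* Mills' ratio bounds the solution
   [(cut_cdf h w - cut_mean h * std_cdf w) / normal_pdf 0 1 w]. *)
Lemma stein_equation h : continuous h -> (forall x, 0 <= h x <= 1) ->
  exists f : R -> R,
    [/\ forall w, is_derive w 1 f (w * f w + h w - cut_mean h),
        forall w, `|f w| <= 6 &
        forall w, `|w * f w + h w - cut_mean h| <= 2].
Proof.
move=> ch h01; have /andP[m0 m1] := cut_mean01 ch h01.
pose num w := cut_cdf h w - cut_mean h * std_cdf w.
(* With G = [cut_cdf h w], m = [cut_mean h] and Phi = [std_cdf w], the numerator is G - m Phi, of
   size at most Phi; it also equals m (1 - Phi) - (m - G), of size at most 1 - Phi. *)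
have numB w : `|num w| <= 6 * normal_pdf 0 1 w /\ `|w| * `|num w| <= normal_pdf 0 1 w.
  have G0 := cut_cdf_ge0 h01 w; have Gm := cut_cdf_le_mean ch h01 w.
  have GP := cut_cdf_le_std ch h01 w; have TP := cut_tail_le_std ch h01 w.
  have P0 := std_cdf_ge0 w; have P1 := std_cdf_le1 w.
  by apply: std_tail_bounds; rewrite /num ler_norml; apply/andP; split; nra.
exists (fun w => num w * (normal_pdf 0 1 w)^-1).
have wf w : `|w * (num w * (normal_pdf 0 1 w)^-1)| <= 1.
  rewrite mulrA normrM normfV (gtr0_norm (std_pdf_gt0 w)) ler_pdivrMr ?std_pdf_gt0//.
  by rewrite mul1r normrM; case: (numB w).
split=> w.
- have dn : is_derive w 1 num (h w * phi w - cut_mean h * phi w).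
    apply: is_deriveB; first exact: is_derive_cut_cdf.
    by apply: is_deriveZ; exact: is_derive_std_cdf.
  have p0 := std_pdf_gt0 w.
  have dv : is_derive w 1 (fun w => (normal_pdf 0 1 w)^-1)
      (- (normal_pdf 0 1 w) ^- 2 *: (- (w * normal_pdf 0 1 w))).
    by apply: is_deriveV; [rewrite gt_eqF|exact: is_derive_std_pdf].
  apply: (is_derive_eq (is_deriveM dn dv)).
  rewrite /GRing.scale/= /phi; field.
  by rewrite gt_eqF.
- rewrite normrM normfV (gtr0_norm (std_pdf_gt0 w)) ler_pdivrMr ?std_pdf_gt0//.
  by case: (numB w).
(* The bound 2 is 1 for w f(w) plus 1 for the difference of h(w) and its mean, both in [0, 1]. *)
- have := wf w; have /andP[h0 h1] := h01 w.
  rewrite !ler_norml => /andP[A B]; apply/andP; split; lra.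
Qed.

End StandardNormal.

(** * A Berry-Esseen bound for moves of bounded size *)

Section Ramp.
Variable R : realType.
Implicit Types z l w : R.

(** Continuous substitute for the indicator of ]-oo, z]: it is 1 up to z, 0 from z + l on, and
    linear in between when l > 0. *)
Definition ramp z l w : R := Num.max 0 (Num.min 1 ((z + l - w) / l)).

Lemma ramp_continuous z l : continuous (ramp z l).
Proof.
move=> w; apply: (@continuous_max R R (fun=> 0) (fun w => Num.min 1 ((z + l - w) / l))).
  exact: cvg_cst.
apply: (@continuous_min R R (fun=> 1) (fun w => (z + l - w) / l)); first exact: cvg_cst.
apply: cvgM; last exact: cvg_cst.
by apply: cvgB; [exact: cvg_cst|exact: cvg_id].
Qed.

Lemma ramp01 z l w : 0 <= ramp z l w <= 1.
Proof. by rewrite /ramp le_max lexx ge_max ler01 ge_min lexx. Qed.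

Lemma ramp1 z l w : 0 < l -> w <= z -> ramp z l w = 1.
Proof.
move=> l0 wz; have x1 : 1 <= (z + l - w) / l by rewrite ler_pdivlMr//; lra.
by rewrite /ramp; move/min_idPl: x1 => ->; apply/max_idPr.
Qed.

Lemma ramp0 z l w : 0 < l -> z + l <= w -> ramp z l w = 0.
Proof.
move=> l0 wz; have x0 : (z + l - w) / l <= 0 by rewrite ler_pdivrMr//; lra.
by rewrite /ramp; apply/max_idPl; rewrite ge_min x0 orbT.
Qed.

Lemma ramp_lip z l a b : 0 < l -> `|ramp z l a - ramp z l b| <= `|a - b| / l.
Proof.
move=> l0.
have -> : `|a - b| / l = `|(z + l - a) / l - (z + l - b) / l|.
  rewrite -mulrBl normrM normfV (gtr0_norm l0); congr (_ / _).
  by rewrite -normrN; congr Num.norm; ring.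
rewrite /ramp; move: ((z + l - a) / l) ((z + l - b) / l) => x y.
have clipE (u : R) : Num.max 0 (Num.min 1 u) = (if u <= 0 then 0 else if 1 <= u then 1 else u).
  case: (leP u 0) => u0; first by apply/max_idPl; rewrite ge_min u0 orbT.
  case: (leP 1 u) => u1; first by apply/max_idPr.
  by apply/max_idPr/ltW.
rewrite !clipE ler_norml; case: (leP x 0) => x0; case: (leP y 0) => y0;
  case: (leP 1 x) => x1; case: (leP 1 y) => y1;
  case: (ger0P (x - y)) => xy; apply/andP; split; lra.
Qed.

(** The ramp is constant on either side of [z, z + l], so a short step is felt only near this
    interval. Keeping the indicator is what brings the Kolmogorov distance into the error term. *)
Lemma ramp_diff z l d a b : 0 < l -> `|a - b| <= d ->
  `|ramp z l a - ramp z l b| <= d / l * ((z - d <= b) && (b <= z + l + d))%:R.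
Proof.
move=> l0 abd.
have d0 : 0 <= d := le_trans (normr_ge0 _) abd.
case: (boolP (_ && _)) => [_|].
  by rewrite mulr1 (le_trans (ramp_lip _ _ _ l0))// ler_pM2r ?invr_gt0.
move: abd; rewrite ler_norml => /andP[A B].
rewrite negb_and -!ltNge mulr0 => /orP[bz|bz].
  by rewrite !ramp1 ?subrr ?normr0//; lra.
by rewrite !ramp0 ?subrr ?normr0//; lra.
Qed.

End Ramp.

(** * Averages over a finite probability space *)

Section Mean.
Variables (R : realType) (T : finType).
Implicit Types F G : T -> R.

Definition mean F : R := (\sum_x F x) / #|T|%:R.

Lemma eq_mean F G : F =1 G -> mean F = mean G.
Proof. by move=> FG; rewrite /mean; congr (_ / _); apply: eq_bigr. Qed.

Lemma meanD F G : mean (fun x => F x + G x) = mean F + mean G.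
Proof. by rewrite /mean big_split/= mulrDl. Qed.

Lemma meanB F G : mean (fun x => F x - G x) = mean F - mean G.
Proof. by rewrite /mean big_split/= sumrN mulrBl. Qed.

Lemma meanZ a F : mean (fun x => a * F x) = a * mean F.
Proof. by rewrite /mean -mulr_sumr mulrA. Qed.

Lemma mean_sum (I : finType) (P : pred I) (F : I -> T -> R) :
  mean (fun x => \sum_(i | P i) F i x) = \sum_(i | P i) mean (F i).
Proof. by rewrite /mean exchange_big mulr_suml. Qed.

Lemma le_mean F G : (forall x, F x <= G x) -> mean F <= mean G.
Proof. by move=> FG; rewrite /mean ler_wpM2r ?invr_ge0// ler_sum. Qed.

Lemma mean_ge0 F : (forall x, 0 <= F x) -> 0 <= mean F.
Proof. by move=> F0; rewrite /mean divr_ge0// sumr_ge0. Qed.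

Lemma ler_norm_mean F : `|mean F| <= mean (fun x => `|F x|).
Proof. by rewrite /mean normrM normfV normr_nat ler_wpM2r ?invr_ge0// ler_norm_sum. Qed.

Lemma mean_cst a : (0 < #|T|)%N -> mean (fun=> a) = a.
Proof.
move=> T0; rewrite /mean sumr_const -[a *+ _]mulr_natr mulfK//.
by rewrite pnatr_eq0 -lt0n.
Qed.

(** In place of the Cauchy-Schwarz inequality, |F| <= t/2 + F^2 / (2 t) is averaged. *)
Lemma mean_norm_le F t : (0 < #|T|)%N -> 0 < t ->
  mean (fun x => F x ^+ 2) <= t ^+ 2 -> mean (fun x => `|F x|) <= t.
Proof.
move=> T0 t0 Ft.
apply: (@le_trans _ _ (mean (fun x => 2^-1 * t + (2 * t)^-1 * F x ^+ 2))).
  apply: le_mean => x.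
  have -> : 2^-1 * t + (2 * t)^-1 * F x ^+ 2 = (t ^+ 2 + F x ^+ 2) / (2 * t).
    by field; rewrite gt_eqF.
  rewrite ler_pdivlMr ?mulr_gt0// -(real_normK (num_real (F x))).
  by have := sqr_ge0 (t - `|F x|); nra.
rewrite meanD mean_cst// meanZ.
apply: (@le_trans _ _ (2^-1 * t + (2 * t)^-1 * t ^+ 2)).
  by rewrite lerD2l ler_wpM2l// invr_ge0 mulr_ge0// ltW.
by rewrite le_eqVlt; apply/orP; left; apply/eqP; field; rewrite gt_eqF.
Qed.

End Mean.

(** * Stein's method with an exact identity for weighted moves *)

Section SteinBound.
Variables (R : realType) (T K : finType) (W : T -> R) (v : K -> T -> R)
  (tau : K -> T -> T) (V d eps : R).
Hypothesis T_gt0 : (0 < #|T|)%N.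
Hypothesis steinW : forall F : R -> R,
  mean (fun x => W x * F (W x)) =
  \sum_k mean (fun x => v k x * (F (W (tau k x)) - F (W x))).
Hypothesis v_ge0 : forall k x, 0 <= v k x.
Hypothesis v_le : forall x, \sum_k v k x <= V.
Hypothesis W_close : forall k x, `|W (tau k x) - W x| <= d.
Hypothesis W_var : mean (fun x => W x ^+ 2) = 1.
(** The Stein identity with F = id gives this sum the mean 1; its mean distance from 1 is one of the
    two error sources. *)
Let S x := \sum_k v k x * (W (tau k x) - W x).
Hypothesis S_close : mean (fun x => `|S x - 1|) <= eps.

Let c := V * d ^+ 2.
Definition cdf_gap t := `|mean (fun x => (W x <= t)%R%:R) - std_cdf t|.

Let V_ge0 : 0 <= V.
Proof.
have /card_gt0P[x _] := T_gt0.
by apply: le_trans (v_le x); apply: sumr_ge0.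
Qed.

Let mean_S : mean S = 1.
Proof.
rewrite -W_var (steinW id) /S.
by rewrite mean_sum.
Qed.

Let d_ge0 : 0 <= d.
Proof.
have [k _|K0] := pickP (pred_of_argType K).
  by have /card_gt0P[x _] := T_gt0; apply: le_trans (W_close k x).
have := mean_S; rewrite /S (@eq_mean _ _ _ (fun=> 0)); last first.
  by move=> x; rewrite big_pred0.
by rewrite mean_cst// => /eqP; rewrite eq_sym oner_eq0.
Qed.

(** The sum S has mean 1 and is at most V d pointwise, so V d >= 1. Terms of order d can thus be
    absorbed into c. *)
Let d_le : d <= c.
Proof.
suff Vd : 1 <= V * d by rewrite /c expr2 mulrA -[leLHS]mul1r ler_wpM2r.
rewrite -mean_S -[leRHS](mean_cst _ T_gt0); apply: le_mean => x.
apply: (@le_trans _ _ (\sum_k v k x * d)); last by rewrite -mulr_suml ler_wpM2r.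
apply: ler_sum => k _; rewrite ler_wpM2l//.
exact: le_trans (ler_norm _) (W_close k x).
Qed.

Let c_gt0 : 0 < c.
Proof.
rewrite lt_neqAle (le_trans d_ge0 d_le) andbT eq_sym; apply/eqP => c0.
have d0 : d = 0 by apply/eqP; rewrite eq_le d_ge0 -c0 d_le.
have := mean_S; rewrite (@eq_mean _ _ _ (fun=> 0)).
  by rewrite mean_cst// => /eqP; rewrite eq_sym oner_eq0.
move=> x; rewrite /S big1// => k _.
by have := W_close k x; rewrite d0 normr_le0 => /eqP ->; rewrite mulr0.
Qed.

Let d_gt0 : 0 < d.
Proof.
rewrite lt_neqAle d_ge0 andbT eq_sym; apply/eqP => d0.
by have := c_gt0; rewrite /c d0 expr0n mulr0 ltxx.
Qed.

Let mean_absW : mean (fun x => `|W x|) <= 1.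
Proof. by apply: mean_norm_le; rewrite // W_var expr1n. Qed.

(** The Stein equation for the ramp leaves two errors: [2 * eps] from f'(W) (1 - S), and the
    second-order remainders of f along the moves. The slope of the ramp enters the latter only
    through the probability that W is near [z, z + l]. *)
Lemma stein_smooth z l D : 0 < l -> (forall t, cdf_gap t <= D) ->
  `|mean (fun x => ramp z l (W x)) - cut_mean (ramp z l)|
  <= 2 * eps + c * (8 + (l + 3 * d + 2 * D) / l).
Proof.
move=> l0 gapD.
have [f [df f6 f2]] := stein_equation (@ramp_continuous R z l) (@ramp01 R z l).
set Nh := cut_mean _; pose f' (w : R) := w * f w + ramp z l w - Nh.
(* Mean value theorem in either order of a and b; only the distance of the intermediate point from b
   is retained. *)
have flip (a b : R) : exists2 c, `|c - b| <= `|a - b| & f a - f b = f' c * (a - b).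
  wlog ab : a b / b <= a => [H|].
    have [ab|/ltW ab] := leP b a; first exact: H.
    have cont : {within `[a, b], continuous f}.
      apply: derivable_within_continuous => x _.
      exact: (@ex_derive _ _ _ _ _ _ _ (df x)).
    have [e] := @MVT_segment R f f' a b ab (fun x _ => df x) cont.
    rewrite in_itv/= => /andP[ae eb] E.
    exists e; first by rewrite !ler0_norm; lra.
    by rewrite -opprB E -mulrN opprB.
  have cont : {within `[b, a], continuous f}.
    apply: derivable_within_continuous => x _.
    exact: (@ex_derive _ _ _ _ _ _ _ (df x)).
  have [e] := @MVT_segment R f f' b a ab (fun x _ => df x) cont.
  rewrite in_itv/= => /andP[ae eb] E.
  by exists e => //; rewrite !ger0_norm; lra.
have f2lip (a b : R) : `|f a - f b| <= 2 * `|a - b|.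
  have [e _ ->] := flip a b; rewrite normrM ler_wpM2r//; exact: f2.
pose near (w : R) := ((z - d <= w) && (w <= z + l + d))%:R : R.
have f'lip (a b : R) : `|a - b| <= d ->
    `|f' a - f' b| <= d * (6 + 2 * `|b| + near b / l).
  move=> abd.
  (* The three differences carry the constants 6 (bound on f), 2 |b| (Lipschitz constant of f) and
     1/l (slope of the ramp). *)
  have -> : f' a - f' b = (a - b) * f a + b * (f a - f b) + (ramp z l a - ramp z l b).
    by rewrite /f'; ring.
  apply: le_trans (ler_normD _ _) _.
  have -> : d * (6 + 2 * `|b| + near b / l) = d * 6 + `|b| * (2 * d) + d / l * near b.
    by ring.
  apply: lerD; last exact: ramp_diff.
  apply: le_trans (ler_normD _ _) _; rewrite !normrM; apply: lerD.
    exact: ler_pM.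
  by rewrite ler_wpM2l// (le_trans (f2lip _ _))// ler_wpM2l.
pose rem k x := f (W (tau k x)) - f (W x) - f' (W x) * (W (tau k x) - W x).
have remB k x : `|rem k x| <= d ^+ 2 * (6 + 2 * `|W x| + near (W x) / l).
  rewrite /rem; have [e ewb ->] := flip (W (tau k x)) (W x).
  rewrite -mulrBl normrM mulrC expr2 -mulrA.
  apply: ler_pM => //; apply: f'lip; exact: le_trans ewb (W_close k x).
(* The Stein equation rewrites the left side as the mean of f'(W) - W f(W); the identity for the
   moves and a first-order expansion of f then produce S and the remainders. *)
have splitE : mean (fun x => ramp z l (W x)) - Nh =
    mean (fun x => f' (W x) * (1 - S x)) - mean (fun x => \sum_k v k x * rem k x).
  have -> : mean (fun x => ramp z l (W x)) - Nh =
      mean (fun x => f' (W x)) - mean (fun x => W x * f (W x)).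
    rewrite -meanB -[X in _ - X](mean_cst _ T_gt0) -meanB; apply: eq_mean => x.
    by rewrite /f'; ring.
  rewrite steinW -mean_sum -!meanB; apply: eq_mean => x.
  have -> : \sum_k v k x * rem k x =
      \sum_k v k x * (f (W (tau k x)) - f (W x)) - f' (W x) * S x.
    rewrite mulr_sumr -sumrB; apply: eq_bigr => k _.
    by rewrite /rem; ring.
  by ring.
rewrite splitE; apply: le_trans (ler_normB _ _) _; apply: lerD.
  apply: le_trans (ler_norm_mean _) _.
  apply: (@le_trans _ _ (mean (fun x => 2 * `|S x - 1|))); last by rewrite meanZ ler_wpM2l.
  by apply: le_mean => x; rewrite normrM [`|1 - _|]distrC ler_wpM2r//; exact: f2.
apply: le_trans (ler_norm_mean _) _.
apply: (@le_trans _ _ (mean (fun x => c * (6 + 2 * `|W x| + near (W x) / l)))).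
  apply: le_mean => x; apply: le_trans (ler_norm_sum _ _ _) _.
  have n0 : 0 <= 6 + 2 * `|W x| + near (W x) / l.
    by rewrite !addr_ge0 ?mulr_ge0 ?invr_ge0 ?ler0n// ltW.
  apply: (@le_trans _ _ (\sum_k v k x * (d ^+ 2 * (6 + 2 * `|W x| + near (W x) / l)))).
    by apply: ler_sum => k _; rewrite normrM ger0_norm// ler_wpM2l.
  by rewrite -mulr_suml /c -mulrA ler_wpM2r// mulr_ge0 ?sqr_ge0.
rewrite meanZ ler_pM2l// !meanD mean_cst// meanZ.
have -> : 8 = 6 + 2 * 1 :> R by ring.
apply: lerD; first by rewrite lerD2l ler_wpM2l.
under eq_mean do rewrite mulrC; rewrite meanZ mulrC ler_pM2r ?invr_gt0//.
(* Since d > 0, passing to z - 2 d turns the closed left end into a difference of distribution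
   functions; the interval then has length l + 3 d, and each end costs one D. *)
apply: (@le_trans _ _ (mean (fun x => (W x <= z + l + d)%R%:R - (W x <= z - 2 * d)%R%:R))).
  apply: le_mean => x; rewrite /near.
  have dp := d_gt0; case: (leP (z - d) (W x)) => h1; case: (leP (W x) (z + l + d)) => h2;
    case: (leP (W x) (z - 2 * d)) => h3 /=; rewrite ?mulr1n ?mulr0n; lra.
rewrite meanB.
have := gapD (z + l + d); have := gapD (z - 2 * d); rewrite /cdf_gap !ler_norml.
move=> /andP[A1 A2] /andP[B1 B2].
have /andP[_] : 0 <= std_cdf (z + l + d) - std_cdf (z - 2 * d) <= z + l + d - (z - 2 * d).
  by apply: std_cdf_lip; have := d_gt0; lra.
lra.
Qed.

(* The smoothing width [4 * c] makes the coefficient of [D] equal to 1/2. *)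
Lemma stein_bootstrap D t : (forall t, cdf_gap t <= D) ->
  cdf_gap t <= D / 2 + (14 * c + 2 * eps).
Proof.
move=> gapD; have l0 : 0 < 4 * c by rewrite mulr_gt0.
(* As d <= c, the first two terms are at most 9.75 c; moving the ramp by its width costs another 4 c
   in the normal distribution function, which gives 14 c. *)
have E : c * (8 + (4 * c + 3 * d + 2 * D) / (4 * c)) = 9 * c + 3 / 4 * d + D / 2.
  by field; rewrite gt_eqF.
have dc := d_le.
have up : mean (fun x => (W x <= t)%R%:R) - std_cdf t <= D / 2 + (14 * c + 2 * eps).
  have := stein_smooth t l0 gapD; rewrite E ler_norml => /andP[_ B].
  have h1 : mean (fun x => (W x <= t)%R%:R) <= mean (fun x => ramp t (4 * c) (W x)).
    apply: le_mean => x; case: (leP (W x) t) => [wt|_]; first by rewrite ramp1.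
    by case/andP: (ramp01 t (4 * c) (W x)).
  have h2 : cut_mean (ramp t (4 * c)) <= std_cdf (t + 4 * c).
    apply: cut_mean_le_std; [exact: ramp_continuous|exact: ramp01|].
    by move=> x xt; rewrite ramp0// ltW.
  have /andP[_ h3] : 0 <= std_cdf (t + 4 * c) - std_cdf t <= t + 4 * c - t.
    by apply: std_cdf_lip; lra.
  lra.
have lo : std_cdf t - mean (fun x => (W x <= t)%R%:R) <= D / 2 + (14 * c + 2 * eps).
  (* Shifted left by its width, the ramp vanishes beyond t and lies below the indicator. *)
  have := stein_smooth (t - 4 * c) l0 gapD; rewrite E ler_norml => /andP[B _].
  have h1 : mean (fun x => ramp (t - 4 * c) (4 * c) (W x)) <= mean (fun x => (W x <= t)%R%:R).
    apply: le_mean => x; case: (leP (W x) t) => [wt|wt]; last by rewrite ramp0 ?subrK// ltW.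
    by case/andP: (ramp01 (t - 4 * c) (4 * c) (W x)).
  have h2 : std_cdf (t - 4 * c) <= cut_mean (ramp (t - 4 * c) (4 * c)).
    apply: std_le_cut_mean; [exact: ramp_continuous|exact: ramp01|].
    by move=> x xt; rewrite ramp1.
  have /andP[_ h3] : 0 <= std_cdf t - std_cdf (t - 4 * c) <= t - (t - 4 * c).
    by apply: std_cdf_lip; lra.
  lra.
by rewrite /cdf_gap ler_norml; apply/andP; split; lra.
Qed.

(** The supremum D of the gaps is finite, each gap being at most 1, so D <= D/2 + B can be solved to
    D <= 2 B. *)
Theorem stein_berry_esseen t : cdf_gap t <= 28 * (V * d ^+ 2) + 4 * eps.
Proof.
pose A := [set cdf_gap t | t in [set: R]].
have gap1 s : cdf_gap s <= 1.
  rewrite /cdf_gap; have m0 : 0 <= mean (fun x => (W x <= s)%R%:R) :> R by exact: mean_ge0.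
  have m1 : mean (fun x => (W x <= s)%R%:R) <= 1 :> R.
    by rewrite -[leRHS](mean_cst _ T_gt0); apply: le_mean => x; rewrite lern1 leq_b1.
  have := std_cdf_ge0 s; have := std_cdf_le1 s; rewrite ler_norml => s1 s0.
  by apply/andP; split; lra.
have ubA : has_ubound A by exists 1 => _ [s _ <-].
have leA s : cdf_gap s <= sup A by apply: ub_le_sup => //; exists s.
have : sup A <= sup A / 2 + (14 * c + 2 * eps).
  apply: ge_sup; first by exists (cdf_gap 0), 0.
  by move=> _ [s _ <-]; exact: stein_bootstrap.
have := leA t; rewrite -/c; lra.
Qed.

End SteinBound.

(** * Resampling one ball *)

Section Resampling.
Variables (R : realType) (n m : nat).
Hypothesis m_gt0 : (0 < m)%N.
Notation config := {ffun 'I_n -> 'I_m}.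
Implicit Types (x y : config) (F G : config -> R).

Definition upd x (j : 'I_n) (u : 'I_m) : config :=
  [ffun i => if i == j then u else x i].

Lemma upd_same x j u : upd x j u j = u.
Proof. by rewrite ffunE eqxx. Qed.

Lemma upd_id x j : upd x j (x j) = x.
Proof. by apply/ffunP => i; rewrite ffunE; case: eqP => [->|]. Qed.

Lemma upd_upd x j u v : upd (upd x j u) j v = upd x j v.
Proof. by apply/ffunP => i; rewrite !ffunE; case: eqP. Qed.

Lemma updC x j k u v : j != k -> upd (upd x j u) k v = upd (upd x k v) j u.
Proof.
move=> jk; apply/ffunP => i; rewrite !ffunE.
by case: (eqVneq i k) => // ->; rewrite eq_sym (negbTE jk).
Qed.

(** Conditional expectation given all balls other than j. *)
Definition resample (j : 'I_n) F x : R := (\sum_u F (upd x j u)) / m%:R.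

Lemma mean_resample j F : mean (resample j F) = mean F.
Proof.
rewrite /mean /resample; congr (_ / _); rewrite -mulr_suml.
have m0 : m%:R != 0 :> R by rewrite pnatr_eq0 -lt0n.
apply: (canLR (mulfK m0)).
rewrite pair_bigA/=.
(* Exchanging the urn of ball j with the fresh urn is an involution of the pairs (configuration,
   urn). *)
pose h (p : config * 'I_m) := (upd p.1 j p.2, p.1 j).
have hK : involutive h by case=> x u; rewrite /h/= upd_upd upd_id upd_same.
rewrite (reindex_inj (inv_inj hK))/=.
under eq_bigr => p _ do rewrite upd_upd upd_id.
rewrite -(pair_bigA _ (fun x _ => F x))/= mulr_suml.
by apply: eq_bigr => x _; rewrite sumr_const card_ord mulr_natr.
Qed.

Section BoundedDifferences.
Variables (L : R).

Definition bounded_diff F := forall x j u, `|F (upd x j u) - F x| <= L.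

Let m0 : 0 < m%:R :> R. Proof. by rewrite ltr0n. Qed.

Lemma bounded_diff_resample j F : bounded_diff F -> bounded_diff (resample j F).
Proof.
move=> FL x k u; rewrite /resample -mulrBl -sumrB normrM normfV normr_nat.
rewrite ler_pdivrMr//; apply: le_trans (ler_norm_sum _ _ _) _.
apply: (@le_trans _ _ (\sum_(v < m) L)); last first.
  by rewrite sumr_const card_ord mulr_natr.
apply: ler_sum => v _; case: (eqVneq j k) => [->|jk].
  by rewrite upd_upd subrr normr0 (le_trans _ (FL x k u)).
by rewrite -(updC _ _ _ jk).
Qed.

Lemma resample_indep j k F : (forall x u, F (upd x k u) = F x) ->
  forall x u, resample j F (upd x k u) = resample j F x.
Proof.
move=> Fk x u; rewrite /resample; congr (_ / _); apply: eq_bigr => v _.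
case: (eqVneq j k) => [->|jk]; first by rewrite upd_upd.
by rewrite -updC.
Qed.

Lemma resample_indep_self j F x u : resample j F (upd x j u) = resample j F x.
Proof. by rewrite /resample; congr (_ / _); apply: eq_bigr => v _; rewrite upd_upd. Qed.

(** With the other balls fixed, the values of F differ from each other by at most L, hence from
    their average too; so the conditional variance is at most L^2. *)
Lemma mean_sqr_resample j F : bounded_diff F ->
  mean (fun x => F x ^+ 2) <= mean (fun x => resample j F x ^+ 2) + L ^+ 2.
Proof.
move=> FL.
have [T0|T0] := leqP #|{: config}| 0.
  have c0 : #|{: config}| = 0%N by apply/eqP; rewrite -leqn0.
  by rewrite /mean c0 invr0 !mulr0 add0r sqr_ge0.
rewrite -[leLHS](mean_resample j) -[L ^+ 2](mean_cst _ T0) -meanD.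
apply: le_mean => x; rewrite /resample.
set a := fun u => F (upd x j u).
have aL u v : `|a u - a v| <= L by rewrite -[a u]/(F _) -(upd_upd x j v u); exact: FL.
set b := (\sum_u F (upd x j u)) / m%:R.
have bE : \sum_u a u = m%:R * b by rewrite mulrC divfK// gt_eqF.
have ab u : `|a u - b| <= L.
  have -> : a u - b = (\sum_v (a u - a v)) / m%:R.
    rewrite sumrB sumr_const card_ord bE -[a u *+ m]mulr_natr; field.
    by rewrite gt_eqF.
  rewrite normrM normfV normr_nat ler_pdivrMr//; apply: le_trans (ler_norm_sum _ _ _) _.
  apply: (@le_trans _ _ (\sum_(v < m) L)); first exact: ler_sum.
  by rewrite sumr_const card_ord mulr_natr.
rewrite ler_pdivrMr//.
(* Spread over u in this form, the claim becomes (a u - b)^2 <= L^2 term by term. *)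
have -> : (b ^+ 2 + L ^+ 2) * m%:R = \sum_(u < m) (2 * b * a u + (L ^+ 2 - b ^+ 2)).
  rewrite big_split/= -mulr_sumr bE sumr_const card_ord -mulr_natr; ring.
apply: ler_sum => u _; rewrite -[F _]/(a u).
have : (a u - b) ^+ 2 <= L ^+ 2.
  rewrite -real_normK ?num_real// lerXn2r ?nnegrE//.
  exact: le_trans (ab u).
lra.
Qed.

(** The coordinates of x are replaced by those of y one after the other. *)
Lemma resample_invariant_cst F : (forall x j u, F (upd x j u) = F x) ->
  forall x y, F x = F y.
Proof.
move=> Finv x y.
pose z s := foldr (fun j x' => upd x' j (y j)) x s.
have zE s i : z s i = if i \in s then y i else x i.
  by elim: s => //= j s IH; rewrite ffunE inE; case: eqP => [->|].
have Fz s : F (z s) = F x by elim: s => //= j s IH; rewrite Finv.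
rewrite -(Fz (enum 'I_n)); congr F; apply/ffunP => i.
by rewrite zE mem_enum.
Qed.

(* Averaging out one coordinate at a time lowers the second moment by at most
   [L ^+ 2] per coordinate and ends with the constant [mean F]. *)
Lemma variance_bounded_diff F : bounded_diff F ->
  mean (fun x => (F x - mean F) ^+ 2) <= n%:R * L ^+ 2.
Proof.
move=> FL.
have [T0|T0] := leqP #|{: config}| 0.
  have c0 : #|{: config}| = 0%N by apply/eqP; rewrite -leqn0.
  by rewrite {1}/mean c0 invr0 mulr0 mulr_ge0 ?sqr_ge0.
pose G s := foldr resample F s.
have GL s : bounded_diff (G s) by elim: s => //= j s IH; exact: bounded_diff_resample.
have Gm s : mean (G s) = mean F by elim: s => //= j s IH; rewrite mean_resample.
have Gsqr s : mean (fun x => F x ^+ 2) <= mean (fun x => G s x ^+ 2) + (size s)%:R * L ^+ 2.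
  elim: s => [|j s IH]; first by rewrite mul0r addr0.
  apply: le_trans IH _; rewrite /= -natr1 mulrDl mul1r.
  by have := mean_sqr_resample j (GL s); lra.
have Ginv s x j u : j \in s -> G s (upd x j u) = G s x.
  elim: s x u => //= k s IH x u; rewrite inE; case: eqVneq => [->|jk]/=.
    by rewrite resample_indep_self.
  by move=> js; apply: resample_indep => {}x {}u; exact: IH.
have Gcst x : G (enum 'I_n) x = mean F.
  rewrite -(Gm (enum 'I_n)) -[LHS](mean_cst _ T0); apply: eq_mean => y.
  by apply: resample_invariant_cst => z j u; apply: Ginv; rewrite mem_enum.
have := Gsqr (enum 'I_n); rewrite size_enum_ord.
rewrite (@eq_mean _ _ (fun x => G (enum 'I_n) x ^+ 2) (fun=> mean F ^+ 2)) ?mean_cst//; last by move=> x; rewrite Gcst.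
have -> : mean (fun x => (F x - mean F) ^+ 2) = mean (fun x => F x ^+ 2) - mean F ^+ 2.
  have -> : mean F ^+ 2 = 2 * mean F * mean F - mean F ^+ 2 by ring.
  rewrite -[X in _ - (_ - X)](mean_cst _ T0) -meanZ -!meanB.
  by apply: eq_mean => x; ring.
lra.
Qed.

End BoundedDifferences.
End Resampling.

(** * Occupation numbers *)

Section Occupation.
Variables (R : realType) (n m : nat).
Notation config := {ffun 'I_n -> 'I_m}.
Implicit Types (x y : config) (F G : config -> R) (f : nat -> R).

Definition cnt x (u : 'I_m) : nat := \sum_j (x j == u).

Lemma cnt_upd x j u w : (cnt (upd x j u) w + (x j == w) = cnt x w + (u == w))%N.
Proof.
rewrite /cnt (bigD1 j)//= [in RHS](bigD1 j)//= upd_same.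
rewrite (eq_bigr (fun i => (x i == w) : nat)); last first.
  by move=> i ij; rewrite ffunE (negbTE ij).
by rewrite addnC addnAC addnA.
Qed.

Lemma sum_balls (h : 'I_m -> R) x : \sum_i h (x i) = \sum_u (cnt x u)%:R * h u.
Proof.
rewrite (partition_big x xpredT)//=; apply: eq_bigr => u _.
rewrite /cnt natr_sum mulr_suml [LHS]big_mkcond/=; apply: eq_bigr => j _.
by case: eqVneq => [->|]; rewrite ?mul1r ?mul0r.
Qed.

Lemma sum_cnt x : \sum_u (cnt x u)%:R = n%:R :> R.
Proof.
have := sum_balls (fun=> 1) x; rewrite sumr_const card_ord => ->.
by apply: eq_bigr => u _; rewrite mulr1.
Qed.

Lemma sum_in_urn x u : \sum_j (x j == u)%:R = (cnt x u)%:R :> R.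
Proof. by rewrite /cnt natr_sum. Qed.

(* Adding a ball to urn [u] is what conditioning on a larger occupation number
   of [u] does; the right-hand side is the Stein operator of the binomial law. *)
Lemma urn_stein_identity u f F : (0 < m)%N ->
  \sum_j mean (fun x => f (cnt x u) * (F (upd x j u) - F x)) =
  mean (fun x => ((m%:R - 1) * (cnt x u)%:R * f (cnt x u).-1
                  - (n%:R - (cnt x u)%:R) * f (cnt x u)) * F x).
Proof.
move=> m_gt0.
have m0 : m%:R != 0 :> R by rewrite pnatr_eq0 -lt0n.
have ball j : mean (fun x => f (cnt x u) * (F (upd x j u) - F x)) =
    mean (fun x => ((m%:R - 1) * (x j == u)%:R * f (cnt x u).-1
                  - (1 - (x j == u)%:R) * f (cnt x u)) * F x).
  pose G1 x := (1 - (x j == u)%:R) * f (cnt x u) * F (upd x j u).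
  pose G2 x := (m%:R - 1) * (x j == u)%:R * f (cnt x u).-1 * F x.
  (* Once ball j is resampled, [G1] receives equal contributions from the m - 1 urns other than u,
     whereas [G2] receives one, from u, with the factor m - 1. *)
  have E : mean G1 = mean G2.
    rewrite -(mean_resample m_gt0 j G1) -(mean_resample m_gt0 j G2).
    apply: eq_mean => x; rewrite /resample; congr (_ / _).
    pose c := cnt (upd x j u) u.
    have cE v : (v == u)%N = false -> cnt (upd x j v) u = c.-1.
      move=> vu; have := cnt_upd (upd x j u) j v u.
      by rewrite upd_upd upd_same eqxx vu addn0 addn1 /c => <-.
    have -> : \sum_v G1 (upd x j v) = \sum_(v | v != u) f c.-1 * F (upd x j u).
      rewrite [RHS]big_mkcond/=; apply: eq_bigr => v _.
      rewrite /G1 upd_same upd_upd; case: eqVneq => [->|/negbTE vu].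
        by rewrite subrr !mul0r.
      by rewrite subr0 mul1r cE.
    have -> : \sum_v G2 (upd x j v) = (m%:R - 1) * (f c.-1 * F (upd x j u)).
      rewrite (bigD1 u)//= big1 ?addr0; last first.
        by move=> v vu; rewrite /G2 upd_same (negbTE vu) mulr0 !mul0r.
      by rewrite /G2 upd_same eqxx mulr1 mulrA.
    rewrite sumr_const -[_ *+ _]mulr_natl; congr (_ * _).
    rewrite -(@natrB _ _ 1)//; congr (_%:R).
    by have := cardC1 u; rewrite card_ord subn1.
  (* A ball already in u does not move, so the increment may be restricted to balls outside u. *)
  transitivity (mean G1 - mean (fun x => (1 - (x j == u)%:R) * f (cnt x u) * F x)).
    rewrite -meanB; apply: eq_mean => x; rewrite /G1.
    by case: eqVneq => [<-|_]; rewrite ?upd_id ?mulr1n ?mulr0n; ring.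
  by rewrite E -meanB; apply: eq_mean => x; rewrite /G2; ring.
rewrite (eq_bigr _ (fun j _ => ball j)) -mean_sum; apply: eq_mean => x.
rewrite -mulr_suml sumrB -!mulr_suml -mulr_sumr sumrB sum_in_urn sumr_const card_ord.
by [].
Qed.

(** Only the old and the new urn of ball j change. The old one contains j, so the predecessor is a
    true subtraction. *)
Lemma sum_cnt_upd f x j u : \sum_w f (cnt (upd x j u) w) = \sum_w f (cnt x w) +
  (x j != u)%:R * (f (cnt x u).+1 - f (cnt x u) + (f (cnt x (x j)).-1 - f (cnt x (x j)))).
Proof.
case: eqVneq => [<-|ju]; first by rewrite upd_id mul0r addr0.
rewrite (bigD1 u)//= (bigD1 (x j))//= [in RHS](bigD1 u)//= [in RHS](bigD1 (x j))//=.
have cu : cnt (upd x j u) u = (cnt x u).+1.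
  by have := cnt_upd x j u u; rewrite eqxx (negbTE ju) addn0 addn1.
have cv : cnt (upd x j u) (x j) = (cnt x (x j)).-1.
  by have := cnt_upd x j u (x j); rewrite eqxx eq_sym (negbTE ju) addn0 addn1 => <-.
rewrite (eq_bigr (fun w => f (cnt x w))).
  by rewrite cu cv mul1r; ring.
move=> w /andP[wu wv]; congr f.
by have := cnt_upd x j u w; rewrite ![_ == w]eq_sym (negbTE wu) (negbTE wv) !addn0.
Qed.

Lemma sum_cnt_upd_le f B x j u : (forall k l, `|f k - f l| <= B) ->
  `|\sum_w f (cnt (upd x j u) w) - \sum_w f (cnt x w)| <= 2 * B.
Proof.
move=> fB; rewrite sum_cnt_upd addrAC subrr add0r.
have B0 : 0 <= B := le_trans (normr_ge0 _) (fB 0%N 0%N).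
case: (_ != _); rewrite ?mul1r ?mul0r ?normr0 ?mulr_ge0//.
apply: le_trans (ler_normD _ _) _; have := fB (cnt x u).+1 (cnt x u).
by have := fB (cnt x (x j)).-1 (cnt x (x j)); lra.
Qed.

End Occupation.

(** * Solving the recursion for the weights *)

Section Weights.
Variables (R : realType) (n m : nat) (b : R).
Hypotheses (b_ge0 : 0 <= b) (m_ge2 : (2 <= m)%N).

(* The Stein equation at [k] determines the weight at [k - 1] from the weight at
   [k], so the recursion runs downwards from [k = n]; [back_weight j] is the
   weight at [k = n - j]. *)
Fixpoint back_weight (j : nat) : R :=
  if j is j'.+1 then (b + j'%:R / (n - j')%:R * back_weight j') / (m%:R - 1) else 0.

Let m1 : 0 < m%:R - 1 :> R.
Proof. by rewrite subr_gt0 ltr1n. Qed.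

Lemma back_weight_ge0 j : 0 <= back_weight j.
Proof.
by elim: j => //= j IH; rewrite divr_ge0 ?(ltW m1)// addr_ge0// mulr_ge0.
Qed.

(** The coefficient j / (n - j) of the recursion is nonnegative and increases with j < n, so
    monotonicity propagates by induction. *)
Lemma back_weight_mono i j : (i <= j < n)%N -> back_weight i <= back_weight j.
Proof.
move=> /andP[ij]; elim: j i ij => [|j IH] i ij jn.
  by move: ij; rewrite leqn0 => /eqP->.
move: ij; rewrite leq_eqVlt => /predU1P[->//|]; rewrite ltnS => ij.
apply: (le_trans (IH _ ij (ltnW jn))).
case: j jn {ij} IH => [|j] jn IH; first exact: back_weight_ge0 1%N.
rewrite [leRHS]/= [leLHS]/= ler_pM2r ?invr_gt0// lerD2l.
apply: ler_pM; rewrite ?back_weight_ge0 ?divr_ge0//; last exact: (IH j (leqnSn j) (ltnW jn)).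
apply: ler_pM; rewrite ?invr_ge0 ?ler_nat//.
rewrite lef_pV2 ?posrE ?ltr0n ?subn_gt0 ?(ltnW jn) ?ler_nat ?leq_sub2l//.
by rewrite (ltn_trans _ jn).
Qed.

(** The value 0 at k = 0 makes the Stein operator vanish on empty urns and confines the failure of
    the recursion to k = 1. *)
Definition weight (k : nat) : R := if k is 0 then 0 else back_weight (n - k).

Lemma weight_ge0 k : 0 <= weight k.
Proof. by case: k => //= k; exact: back_weight_ge0. Qed.

Lemma weight_le1 k : weight k <= weight 1.
Proof.
case: k => [|k]; first exact: weight_ge0.
case: (posnP n) => [n0|n0]; first by rewrite /weight n0 !sub0n.
apply: back_weight_mono; rewrite leq_sub2l//=.
by rewrite subn1 ltn_predL.
Qed.

Lemma weight_rec k : (2 <= k <= n)%N ->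
  (m%:R - 1) * k%:R * weight k.-1 - (n%:R - k%:R) * weight k = b * k%:R.
Proof.
case: k => [|[|k]]// /andP[_ kn].
rewrite /weight succnK; have -> : (n - k.+1 = (n - k.+2).+1)%N by rewrite subnSK.
rewrite /= subKn// natrB//; field.
by rewrite (gt_eqF m1)/= gt_eqF// ltr_wpDr.
Qed.

End Weights.

(** * The Stein identity for the number of non-isolated balls *)

Section NonIsolated.
Variables (R : realType) (n m : nat).
Notation config := {ffun 'I_n -> 'I_m}.
Implicit Types (x y : config) (F G : config -> R).
Hypotheses (m_ge2 : (2 <= m)%N) (n_ge2 : (2 <= n)%N).

(** Urns with exactly one ball correspond to isolated balls. *)
Definition nb_single x : R := \sum_u (cnt x u == 1%N)%:R.
Definition nonisolated x : R := n%:R - nb_single x.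

Let b := mean nb_single / n%:R.
Hypothesis b_gt0 : 0 < b.
Let e := weight n m b.

Let m_gt0 : (0 < m)%N. Proof. exact: leq_trans m_ge2. Qed.
Let n_gt0 : (0 < n)%N. Proof. exact: leq_trans n_ge2. Qed.
Let nR_gt0 : 0 < n%:R :> R. Proof. by rewrite ltr0n. Qed.

Lemma config_card_gt0 : (0 < #|{: config}|)%N.
Proof. by rewrite card_ffun !card_ord expn_gt0 m_gt0. Qed.

Lemma cnt_le x u : (cnt x u <= n)%N.
Proof.
rewrite /cnt -[leqRHS]card_ord -sum1_card; apply: leq_sum => j _.
by case: (_ == _).
Qed.

(** At occupation c the Stein operator is b c for c >= 2 by the recursion, 0 for c = 0 and - (n - 1)
    e(1) for c = 1. The terms b c add up to b n, and the single-ball urns carry the correction. *)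
Let stein_sum F :
  \sum_u \sum_j mean (fun x => e (cnt x u) * (F (upd x j u) - F x)) =
  mean (fun x => (b * n%:R - (b + (n%:R - 1) * e 1) * nb_single x) * F x).
Proof.
under eq_bigr => u _ do rewrite urn_stein_identity//.
rewrite -mean_sum; apply: eq_mean => x; rewrite -mulr_suml; congr (_ * _).
rewrite -(sum_cnt R x) /nb_single !mulr_sumr -sumrB; apply: eq_bigr => u _.
rewrite sum_cnt; move: (cnt_le x u); case: (cnt x u) => [|[|k]] kn.
- by rewrite /e /= !(mulr0, mul0r, subr0).
- by rewrite eqxx /= !(mulr0, mulr1) sub0r; ring.
- by rewrite /= mulr0 subr0 -(@weight_rec R n m b m_ge2).
Qed.

(* Taking [F = 1] in the Stein identity gives the top weight without summing
   binomial probabilities. *)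
Lemma weight1E : (n%:R - 1) * e 1 = 1 - b.
Proof.
have := stein_sum (fun=> 1).
rewrite big1 => [|u _]; last first.
  rewrite big1// => j _; rewrite (@eq_mean _ _ _ (fun=> 0)); last first.
    by move=> x; rewrite subrr mulr0.
  by rewrite mean_cst// config_card_gt0.
rewrite (@eq_mean _ _ _ (fun x => b * n%:R - (b + (n%:R - 1) * e 1) * nb_single x)); last first.
  by move=> x; rewrite mulr1.
rewrite meanB !meanZ mean_cst ?config_card_gt0//.
have bn : mean nb_single = b * n%:R by rewrite /b divfK// gt_eqF.
rewrite bn => /eqP; rewrite eq_sym subr_eq0 => /eqP E.
have bn0 : b * n%:R != 0 by rewrite mulf_neq0// gt_eqF.
have /(mulIf bn0) : 1 * (b * n%:R) = (b + (n%:R - 1) * e 1) * (b * n%:R) by rewrite mul1r.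
by move=> E1; rewrite [X in _ = X - b]E1; ring.
Qed.

(** The value of the top weight makes the coefficient of [nb_single] equal to 1, so the bracket is b
    n - [nb_single], the centred count. *)
Lemma nonisolated_stein F :
  mean (fun x => (nonisolated x - mean nonisolated) * F x) =
  \sum_u \sum_j mean (fun x => e (cnt x u) * (F (upd x j u) - F x)).
Proof.
rewrite stein_sum; apply: eq_mean => x; congr (_ * _).
have -> : mean nonisolated = n%:R - mean nb_single.
  by rewrite /nonisolated meanB mean_cst// config_card_gt0.
rewrite weight1E /nonisolated /b divfK ?gt_eqF//; ring.
Qed.

Lemma nonisolated_upd_le x j u : `|nonisolated (upd x j u) - nonisolated x| <= 2.
Proof.
rewrite /nonisolated opprB addrC addrA subrK distrC.
rewrite -[leRHS]mulr1; apply: (@sum_cnt_upd_le _ _ _ (fun k => (k == 1%N)%:R)).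
move=> k l; case: (_ == _); case: (_ == _);
  by rewrite ?subrr ?subr0 ?sub0r ?normrN ?normr0 ?normr1.
Qed.

Lemma sum_weight_le x : \sum_u e (cnt x u) <= n%:R * e 1.
Proof.
rewrite -(sum_cnt R x) mulr_suml; apply: ler_sum => u _.
case: (cnt x u) => [|k]; first by rewrite mul0r.
apply: le_trans (weight_le1 _ (ltW b_gt0) m_ge2 _) _.
by rewrite ler_peMl ?ler1n// weight_ge0// ltW.
Qed.

(** The unnormalized S; the Stein identity gives it the variance of Y as its mean. *)
Definition stein_kernel x : R :=
  \sum_u \sum_j e (cnt x u) * (nonisolated (upd x j u) - nonisolated x).

Let isol (k : nat) : R := (k == 1%N)%:R.
(** The change in the single-ball indicator of an urn with k balls when one leaves, summed over
    these balls. *)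
Let chi (k : nat) : R := k%:R * (isol k.-1 - isol k).
Let theta (k : nat) : R :=
  e k * (n%:R * (isol k.+1 - isol k) - k%:R * ((isol k.+1 - isol k) + (isol k.-1 - isol k))).

(** Leaving one urn and entering another have additive effects. The departures, summed over all
    balls, do not depend on the target and give the product; [theta] collects the arrivals and the
    correction for balls already in the target. *)
Lemma stein_kernelE x : stein_kernel x =
  - ((\sum_u e (cnt x u)) * (\sum_u chi (cnt x u)) + \sum_u theta (cnt x u)).
Proof.
rewrite mulr_suml -big_split/= -sumrN; apply: eq_bigr => u _.
rewrite /theta -mulr_sumr -mulrDr -mulrN; congr (_ * _).
pose P := isol (cnt x u).+1 - isol (cnt x u).
pose Q k := isol k.-1 - isol k.
transitivity (- \sum_j ((P + Q (cnt x (x j))) - (x j == u)%:R * (P + Q (cnt x u)))).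
  rewrite -sumrN; apply: eq_bigr => j _.
  rewrite /nonisolated /nb_single (@sum_cnt_upd _ _ _ (fun k => isol k)).
  rewrite -/(P) -/(Q _); case: eqVneq => [->|_]; rewrite ?mulr1n ?mulr0n; ring.
congr (- _); rewrite sumrB big_split/= -mulr_suml sum_in_urn.
rewrite (sum_balls (fun v => Q (cnt x v))) sumr_const card_ord -/P -/(Q _).
rewrite -[P *+ n]mulr_natl /chi; ring.
Qed.

Let e_ge0 k : 0 <= e k.
Proof. by apply: weight_ge0 => //; exact: ltW. Qed.
Let e_le1 k : e k <= e 1.
Proof. by apply: weight_le1 => //; exact: ltW. Qed.

(** Product rule: the [chi] sum changes by at most 6 and is at most n in size, the weight sum
    changes by at most 2 e(1) and is at most n e(1), and the [theta] sum changes by at most 2 n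
    e(1). In total 6 + 2 + 2 = 10. *)
Lemma stein_kernel_bounded_diff : bounded_diff (10 * (n%:R * e 1)) stein_kernel.
Proof.
move=> x j u; rewrite !stein_kernelE.
have chiE k : chi k = (k == 2)%:R * 2 - (k == 1%N)%:R.
  rewrite /chi /isol; case: k => [|[|[|k]]]//=; ring.
have dchi : `|\sum_w chi (cnt (upd x j u) w) - \sum_w chi (cnt x w)| <= 2 * 3.
  apply: sum_cnt_upd_le => k l; rewrite !chiE ler_norml.
  by case: k => [|[|[|k]]]//=; case: l => [|[|[|l]]]//=; rewrite ?mulr1n ?mulr0n;
    apply/andP; split; lra.
have chi_n : `|\sum_w chi (cnt x w)| <= n%:R.
  rewrite -(sum_cnt R x); apply: le_trans (ler_norm_sum _ _ _) _; apply: ler_sum => w _.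
  have := ler0n R (cnt x w); rewrite chiE ler_norml.
  case: (cnt x w) => [|[|[|k]]]//= k0; rewrite ?mulr1n ?mulr0n;
  by apply/andP; split; lra.
have de : `|\sum_w e (cnt (upd x j u) w) - \sum_w e (cnt x w)| <= 2 * e 1.
  apply: sum_cnt_upd_le => k l; rewrite ler_norml.
  have := e_ge0 k; have := e_ge0 l; have := e_le1 k; have := e_le1 l.
  by move=> *; apply/andP; split; lra.
have e_n := sum_weight_le (upd x j u).
have e_0 : 0 <= \sum_w e (cnt (upd x j u) w) by apply: sumr_ge0.
(* Only two values can be nonzero: (2 - n) e(1) at k = 1 and - 2 e(2) at k = 2; both use n >= 2. *)
have thetaB k : - (n%:R * e 1) <= theta k <= 0.
  have n2 : 2 <= n%:R :> R by rewrite ler_nat.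
  rewrite /theta /isol; move: (e_ge0 1) (e_ge0 2) (e_le1 2) (erefl : e 0 = 0).
  move: e => f f1 f2 f21 f0.
  have n2f : 2 * f 1 <= n%:R * f 1 by rewrite ler_wpM2r.
  case: k => [|[|[|k]]]; rewrite ?f0 /= ?mulr1n ?mulr0n; apply/andP; split; lra.
have dtheta : `|\sum_w theta (cnt (upd x j u) w) - \sum_w theta (cnt x w)| <= 2 * (n%:R * e 1).
  apply: sum_cnt_upd_le => k l; rewrite ler_norml.
  by have /andP[A1 A2] := thetaB k; have /andP[B1 B2] := thetaB l; apply/andP; split; lra.
move: dchi chi_n de e_n e_0 dtheta.
move: (\sum_w chi (cnt (upd x j u) w)) (\sum_w chi (cnt x w)) => A' A.
move: (\sum_w e (cnt (upd x j u) w)) (\sum_w e (cnt x w)) => E' E.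
move: (\sum_w theta (cnt (upd x j u) w)) (\sum_w theta (cnt x w)) => T' T.
move=> dA A_n dE E_n E_0 dT.
have -> : - (E' * A' + T') - - (E * A + T) = - (E' * (A' - A) + (E' - E) * A + (T' - T)).
  ring.
rewrite normrN; apply: le_trans (ler_normD _ _) _.
apply: le_trans (lerD (ler_normD _ _) (lexx _)) _.
rewrite !normrM (ger0_norm E_0).
have h1 : E' * `|A' - A| <= (n%:R * e 1) * (2 * 3) by apply: ler_pM.
have h2 : `|E' - E| * `|A| <= (2 * e 1) * n%:R by apply: ler_pM.
lra.
Qed.

End NonIsolated.

(** * The bound for fixed n and m *)

Section FiniteBerryEsseen.
Variables (R : realType) (n m : nat).
Notation config := {ffun 'I_n -> 'I_m}.
Implicit Types (x y : config).
Hypotheses (m_ge2 : (2 <= m)%N) (n_ge2 : (2 <= n)%N).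
Let Y := @nonisolated R n m.
Let b := mean (@nb_single R n m) / n%:R.
Hypothesis b_gt0 : 0 < b.
Let s := mean (fun x => (Y x - mean Y) ^+ 2).
Hypothesis s_gt0 : 0 < s.

(** With L = n e(1) and sg the square root of s, the abstract bound applies with V = n L / sg, d = 2
    / sg and eps = 10 sqrt(n) L / s; hence 28 * 4 = 112 and 4 * 10 = 40. *)
Theorem nonisolated_berry_esseen t :
  `|mean (fun x => ((Y x - mean Y) / Num.sqrt s <= t)%R%:R) - std_cdf t| <=
  112 * n%:R * (n%:R / (n%:R - 1) * (1 - b)) / (s * Num.sqrt s) +
  40 * Num.sqrt n%:R * (n%:R / (n%:R - 1) * (1 - b)) / s.
Proof.
set e := weight n m b; set sg := Num.sqrt s; set L := n%:R / _ * _.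
have T0 := @config_card_gt0 n m m_ge2.
have n0 : 0 < n%:R :> R by rewrite ltr0n (leq_trans _ n_ge2).
have n1 : 0 < n%:R - 1 :> R by rewrite subr_gt0 ltr1n.
have sg0 : 0 < sg by rewrite sqrtr_gt0.
have sg2 : sg ^+ 2 = s by rewrite sqr_sqrtr// ltW.
have LE : L = n%:R * e 1.
  rewrite /L -(@weight1E R n m m_ge2 n_ge2 b_gt0) -/b -/e; field.
  by rewrite gt_eqF.
have e_ge0 k : 0 <= e k by apply: weight_ge0 => //; exact: ltW.
pose W x := (Y x - mean Y) / sg.
pose v (k : 'I_m * 'I_n) x := e (cnt x k.1) / sg.
pose tau (k : 'I_m * 'I_n) x := upd x k.2 k.1.
have Wd k x : W (tau k x) - W x = (Y (tau k x) - Y x) / sg.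
  by rewrite /W -mulrBl; congr (_ / _); ring.
have steinW (F : R -> R) : mean (fun x => W x * F (W x)) =
    \sum_k mean (fun x => v k x * (F (W (tau k x)) - F (W x))).
  have := @nonisolated_stein R n m m_ge2 n_ge2 b_gt0 (fun x => F (W x)).
  rewrite -/Y -/b -/e pair_bigA/= => E.
  transitivity (sg^-1 * mean (fun x => (Y x - mean Y) * F (W x))).
    by rewrite -meanZ; apply: eq_mean => x; rewrite /W; ring.
  rewrite E mulr_sumr; apply: eq_bigr => k _; rewrite -meanZ; apply: eq_mean => x.
  by rewrite /v /tau; ring.
have kernelE x : \sum_k v k x * (W (tau k x) - W x) = @stein_kernel R n m x / s.
  rewrite /stein_kernel pair_bigA/= mulr_suml; apply: eq_bigr => k _.
  rewrite Wd /v -sg2 -/b -/e -/Y; field.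
  by rewrite gt_eqF.
have W_var : mean (fun x => W x ^+ 2) = 1.
  transitivity (s^-1 * s); last by rewrite mulVf// gt_eqF.
  rewrite {2}/s -meanZ; apply: eq_mean => x.
  by rewrite /W exprMn exprVn sg2 mulrC.
have kernel_mean : mean (@stein_kernel R n m) = s.
  have := steinW id; rewrite -mean_sum (eq_mean kernelE).
  have -> : mean (fun x => W x * id (W x)) = 1 by rewrite -W_var; apply: eq_mean => x.
  move=> E; transitivity (s * mean (fun x => @stein_kernel R n m x / s)).
    by rewrite -meanZ; apply: eq_mean => x; rewrite mulrC divfK// gt_eqF.
  by rewrite -E mulr1.
have S_close : mean (fun x => `|\sum_k v k x * (W (tau k x) - W x) - 1|)
    <= 10 * Num.sqrt n%:R * L / s.
  rewrite (@eq_mean _ _ _ (fun x => s^-1 * `|@stein_kernel R n m x - s|)); last first.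
    move=> x; rewrite kernelE.
    have -> : @stein_kernel R n m x / s - 1 = s^-1 * (@stein_kernel R n m x - s).
      by rewrite mulrBr mulVf ?gt_eqF// mulrC.
    by rewrite normrM ger0_norm// invr_ge0 ltW.
  rewrite meanZ mulrC ler_pM2r ?invr_gt0//.
  (* [mean_norm_le] requires a positive bound; for L = 0 the kernel has zero differences and equals
     its mean. *)
  have [L0|L0] := ltrP 0 L; last first.
    have L00 : L = 0.
      by apply/eqP; rewrite eq_le L0/= LE mulr_ge0// ltW.
    have bd := @stein_kernel_bounded_diff R n m m_ge2 n_ge2 b_gt0.
    rewrite -/b -/e -LE L00 mulr0 in bd.
    rewrite L00 mulr0 (@eq_mean _ _ _ (fun=> 0)) ?mean_cst// => x.
    have K : forall x y : config, @stein_kernel R n m x = @stein_kernel R n m y.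
      apply: resample_invariant_cst => y j u.
      by have := bd y j u; rewrite normr_le0 subr_eq0 => /eqP.
    rewrite -kernel_mean (@eq_mean _ _ (@stein_kernel R n m) (fun=> @stein_kernel R n m x)).
      by rewrite mean_cst// subrr normr0.
    by move=> y; exact: K.
  apply: mean_norm_le => //; first by rewrite (mulr_gt0 _ L0)// mulr_gt0 ?sqrtr_gt0.
  have := variance_bounded_diff (leq_trans (isT : 0 < 2)%N m_ge2)
    (@stein_kernel_bounded_diff R n m m_ge2 n_ge2 b_gt0).
  rewrite -/b -/e -LE kernel_mean => /le_trans; apply.
  rewrite !exprMn sqr_sqrtr ?(ltW n0)//.
  by rewrite le_eqVlt; apply/orP; left; apply/eqP; ring.
have v_ge0 k x : 0 <= v k x by rewrite divr_ge0// ltW.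
have v_le x : \sum_k v k x <= n%:R * L / sg.
  rewrite -mulr_suml ler_pM2r ?invr_gt0//.
  rewrite -(pair_bigA _ (fun u (j : 'I_n) => e (cnt x u)))/=.
  under eq_bigr => u _ do rewrite sumr_const card_ord -mulr_natl.
  rewrite -mulr_sumr ler_pM2l// LE.
  exact: (@sum_weight_le R n m m_ge2 b_gt0 x).
have W_close k x : `|W (tau k x) - W x| <= 2 / sg.
  rewrite Wd normrM normfV (gtr0_norm sg0) ler_pM2r ?invr_gt0//.
  exact: nonisolated_upd_le.
have := @stein_berry_esseen R _ _ W v tau (n%:R * L / sg) (2 / sg) _
  T0 steinW v_ge0 v_le W_close W_var S_close t.
rewrite /cdf_gap => /le_trans; apply.
rewrite le_eqVlt; apply/orP; left; apply/eqP.
rewrite -sg2; field.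
by rewrite gt_eqF.
Qed.

End FiniteBerryEsseen.

(** * First two moments of the number of single-ball urns *)

Section Moments.
Variables (R : realType) (n m : nat).
Notation config := {ffun 'I_n -> 'I_m}.
Implicit Types (x y : config).
Hypothesis m_gt0 : (0 < m)%N.

Lemma mean_prod (h : 'I_n -> 'I_m -> R) :
  mean (fun x : config => \prod_i h i (x i)) = \prod_i ((\sum_u h i u) / m%:R).
Proof.
rewrite /mean -bigA_distr_bigA/= card_ffun !card_ord.
by rewrite prodf_div prodr_const card_ord natrX.
Qed.

(** Ball j in urn w is consistent with i being the only ball in u. The product over j is the
    indicator of that event, in a form whose mean factorizes. *)
Let fi (i : 'I_n) (u : 'I_m) (j : 'I_n) (w : 'I_m) : R :=
  ((w == u) == (j == i))%:R.

Lemma singletonE x u : (cnt x u == 1%N)%:R = \sum_i \prod_j fi i u j (x j).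
Proof.
have fiE i : \prod_j fi i u j (x j) = (x i == u)%:R * (cnt x u == 1%N)%:R.
  have -> : cnt x u = ((x i == u) + \sum_(j | j != i) (x j == u))%N by rewrite /cnt (bigD1 i).
  rewrite (bigD1 i)//= {1}/fi eqxx eqb_id.
  case: (eqVneq (x i) u) => xiu; last by rewrite !mul0r.
  rewrite !mul1r add1n eqSS sum_nat_eq0.
  case: forallP => H.
    rewrite big1// => j ji; rewrite /fi (negbTE ji).
    by have := H j; rewrite ji/= eqb0 => /negbTE ->.
  apply/eqP; rewrite prodf_seq_eq0; apply: contra_notT H => /hasPn H j.
  apply/implyP => ji; rewrite eqb0; have := H j (mem_index_enum _).
  by rewrite ji/= /fi (negbTE ji) pnatr_eq0 eqb0 negbK eqbF_neg.
under eq_bigr => i _ do rewrite fiE.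
by rewrite -mulr_suml sum_in_urn; case: eqVneq => [->|_]; rewrite ?mul1r ?mulr0.
Qed.

Let m0 : m%:R != 0 :> R. Proof. by rewrite pnatr_eq0 -lt0n. Qed.

Lemma sum_indicator u : \sum_(w < m) (w == u)%:R = 1 :> R.
Proof. by rewrite (bigD1 u)//= eqxx big1 ?addr0// => w /negbTE ->. Qed.

Lemma mean_singletons : mean (@nb_single R n m) = n%:R * (1 - m%:R^-1) ^+ n.-1.
Proof.
rewrite /nb_single mean_sum.
have E u : mean (fun x => (cnt x u == 1%N)%:R) = n%:R * m%:R^-1 * (1 - m%:R^-1) ^+ n.-1 :> R.
  rewrite (eq_mean (singletonE ^~ u)) mean_sum.
  under eq_bigr => i _ do rewrite mean_prod.
  rewrite (eq_bigr (fun=> m%:R^-1 * (1 - m%:R^-1) ^+ n.-1)); last first.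
    move=> i _; rewrite (bigD1 i)//=; congr (_ * _).
      rewrite -[RHS]mul1r -(sum_indicator u); congr (_ / _); apply: eq_bigr => w _.
      by rewrite /fi eqxx eqb_id.
    rewrite (eq_bigr (fun=> 1 - m%:R^-1)); last first.
      move=> j ji; rewrite (eq_bigr (fun w => 1 - (w == u)%:R)); last first.
        by move=> w _; rewrite /fi (negbTE ji); case: (w == u); rewrite ?subrr ?subr0.
      rewrite sumrB sum_indicator sumr_const card_ord mulrBl mul1r; congr (_ - _).
      by rewrite divff.
    by rewrite prodr_const; congr (_ ^+ _); have := cardC1 i; rewrite card_ord.
  by rewrite sumr_const card_ord -[LHS]mulr_natl mulrA.
rewrite (eq_bigr _ (fun u _ => E u)) sumr_const card_ord -[LHS]mulr_natl !mulrA.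
by rewrite [m%:R * _]mulrC mulfK.
Qed.

Lemma mean_two_singletons u v : u != v ->
  mean (fun x => (cnt x u == 1%N)%:R * (cnt x v == 1%N)%:R) =
  (n * n.-1)%:R * m%:R^-1 ^+ 2 * (1 - 2 / m%:R) ^+ n.-2 :> R.
Proof.
move=> uv; pose c : R := m%:R^-1 ^+ 2 * (1 - 2 / m%:R) ^+ n.-2.
have E i k : mean (fun x => (\prod_j fi i u j (x j)) * \prod_j fi k v j (x j)) =
    (k != i)%:R * c.
  rewrite (@eq_mean _ _ _ (fun x => \prod_j (fi i u j (x j) * fi k v j (x j)))); last first.
    by move=> x; rewrite big_split.
  rewrite (mean_prod (fun j w => fi i u j w * fi k v j w)).
  (* One ball cannot lie in two urns; for distinct i and k these two balls are prescribed and the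
     other n - 2 avoid both urns. *)
  case: (eqVneq k i) => [->|ki].
    rewrite (bigD1 i)//= big1 ?mul0r// => w _; rewrite /fi eqxx !eqb_id.
    by case: (eqVneq w u) => [->|]; rewrite ?(negbTE uv) ?mul0r ?mulr0.
  rewrite mul1r (bigD1 i)//= (bigD1 k)//= mulrA; congr (_ * _).
    rewrite expr2; congr (_ * _).
      rewrite -[RHS]mul1r -(sum_indicator u); congr (_ / _); apply: eq_bigr => w _.
      rewrite /fi eqxx eqb_id [i == k]eq_sym (negbTE ki).
      by case: (eqVneq w u) => [->|]; rewrite ?(negbTE uv) ?mul0r ?mul1r.
    rewrite -[RHS]mul1r -(sum_indicator v); congr (_ / _); apply: eq_bigr => w _.
    rewrite /fi eqxx eqb_id (negbTE ki).
    by case: (eqVneq w v) => [->|]; rewrite ?mulr0// [v == u]eq_sym (negbTE uv) mul1r.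
  rewrite (eq_bigr (fun=> 1 - 2 / m%:R)); last first.
    move=> j /andP[ji jk].
    rewrite (eq_bigr (fun w => 1 - (w == u)%:R - (w == v)%:R)); last first.
      move=> w _; rewrite /fi (negbTE ji) (negbTE jk).
      case: (eqVneq w u) => [->|]; first by rewrite (negbTE uv) mul0r subrr subr0.
      by case: (w == v); rewrite ?mulr0 ?mulr1 ?subr0 ?subrr.
    rewrite !sumrB !sum_indicator sumr_const card_ord; field.
    exact: m0.
  rewrite prodr_const; congr (_ ^+ _).
  have := cardC (pred2 i k); rewrite card2 eq_sym ki card_ord => H.
  rewrite -[in RHS]H !addSn add0n /=; apply: eq_card => j.
  by rewrite !inE/= negb_or.
rewrite (@eq_mean _ _ _ (fun x => \sum_i \sum_k
    ((\prod_j fi i u j (x j)) * \prod_j fi k v j (x j)))); last first.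
  move=> x; rewrite !singletonE mulr_suml; apply: eq_bigr => i _.
  by rewrite mulr_sumr.
rewrite mean_sum; under eq_bigr => i _ do rewrite mean_sum.
under eq_bigr => i _ do under eq_bigr => k _ do rewrite E.
under eq_bigr => i _ do rewrite -mulr_suml.
rewrite -mulr_suml -mulrA; congr (_ * _).
rewrite (eq_bigr (fun=> n.-1%:R)); first by rewrite sumr_const card_ord -[LHS]mulr_natl natrM.
move=> i _; rewrite -natr_sum -big_mkcond/= sum1_card.
by congr (_%:R); have := cardC1 i; rewrite card_ord.
Qed.

(** The diagonal of the squared sum is the sum itself; the m (m - 1) ordered pairs of distinct urns
    turn the factor m^(-2) into 1 - 1/m. *)
Lemma mean_sqr_singletons : mean (fun x => @nb_single R n m x ^+ 2) =
  n%:R * (1 - m%:R^-1) ^+ n.-1 +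
  (n * n.-1)%:R * (1 - m%:R^-1) * (1 - 2 / m%:R) ^+ n.-2.
Proof.
rewrite -mean_singletons.
rewrite (@eq_mean _ _ _ (fun x => @nb_single R n m x +
    \sum_(u < m) \sum_(v < m | v != u) (cnt x u == 1%N)%:R * (cnt x v == 1%N)%:R)); last first.
  move=> x; rewrite expr2 /nb_single mulr_suml -big_split/=; apply: eq_bigr => u _.
  rewrite mulr_sumr (bigD1 u)//=; congr (_ + _).
  by case: (_ == _); rewrite ?mulr1 ?mulr0.
rewrite meanD; congr (_ + _); rewrite mean_sum.
under eq_bigr => u _ do rewrite mean_sum.
rewrite (eq_bigr (fun u => m.-1%:R * ((n * n.-1)%:R * m%:R^-1 ^+ 2 * (1 - 2 / m%:R) ^+ n.-2))).
  rewrite sumr_const card_ord -[X in X = _]mulr_natl -subn1 natrB//; field.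
  exact: m0.
move=> u _; rewrite (eq_bigr (fun=> (n * n.-1)%:R * m%:R^-1 ^+ 2 * (1 - 2 / m%:R) ^+ n.-2)).
  rewrite sumr_const -[LHS]mulr_natl; congr (_%:R * _).
  by have := cardC1 u; rewrite card_ord.
by move=> v vu; rewrite mean_two_singletons// eq_sym.
Qed.

End Moments.

(** * From the random variables to uniform configurations *)

Section Transfer.
Context d (T : measurableType d) (R : realType) (P : probability T R).
Variables (n m : nat) (X : 'I_n -> {RV P >-> nat}).
Hypothesis m_gt0 : (0 < m)%N.
Hypothesis X_indep : mutually_independent X.
Hypothesis X_unif : forall i, uniform_on_range m (X i).
Notation config := {ffun 'I_n -> 'I_m}.
Implicit Types z : config.

(** The successor translates the ordinals 0, ..., m - 1 into the urn labels 1, ..., m. *)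
Definition cylinder z : set T := [set w | forall i, X i w = (z i).+1].

Let cylinderE z : cylinder z =
  \bigcap_(i in [set` [set: 'I_n]%SET]) (X i @^-1` [set (z i).+1]).
Proof.
apply/seteqP; split=> w /= H i; first by move=> _; exact: H.
by apply: (H i); rewrite /= inE.
Qed.

Lemma measurable_cylinder z : measurable (cylinder z).
Proof.
rewrite cylinderE; apply: fin_bigcap_measurable; first exact: finite_finset.
by move=> i _; rewrite -[X in measurable X]setTI; exact: measurable_funPT.
Qed.

Lemma prob_cylinder z : P (cylinder z) = (#|{: config}|%:R^-1)%:E.
Proof.
rewrite cylinderE (X_indep [set: 'I_n]%SET (A := fun i => [set (z i).+1]))//.
rewrite (eq_bigr (fun=> (m%:R^-1 : R)%:E)); last first.
  by move=> i _; apply: X_unif; rewrite ltn_ord.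
rewrite prodEFin prodr_const cardsT card_ord.
by rewrite card_ffun !card_ord natrX exprVn.
Qed.

Let cylinder_inj z z' w : cylinder z w -> cylinder z' w -> z = z'.
Proof.
move=> H H'; apply/ffunP => i; apply/val_inj/succn_inj.
by rewrite -(H i) -(H' i).
Qed.

Let step (a : config -> R) w : R := \sum_z a z * \1_(cylinder z) w.

Let stepE a z w : cylinder z w -> step a w = a z.
Proof.
move=> zw; rewrite /step (bigD1 z)//= indicE mem_set// mulr1 big1 ?addr0//.
move=> z' z'z; rewrite indicE memNset ?mulr0// => z'w.
by rewrite (cylinder_inj z'w zw) eqxx in z'z.
Qed.

Let integral_step a : (\int[P]_w (step a w)%:E)%E = (mean a)%:E.
Proof.
rewrite /step; under eq_integral do rewrite -sumEFin.
rewrite integral_sum//; last first.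
  move=> z; apply: (@integrableZl _ _ _ P _ _ (a z) (fun w => (\1_(cylinder z) w)%:E)) => //.
  exact/integrable_indic/measurable_cylinder.
rewrite /mean mulr_suml -sumEFin; apply: eq_bigr => z _.
under eq_integral do rewrite EFinM.
rewrite integralZl//; last exact/integrable_indic/measurable_cylinder.
have mz := measurable_cylinder z.
rewrite integral_indic// setIT EFinM; congr (_ * _)%E.
exact: prob_cylinder.
Qed.

Let measurable_step a : measurable_fun setT (step a).
Proof.
apply: measurable_sum => z; apply: measurable_funM => //.
exact/measurable_indic/measurable_cylinder.
Qed.

(** The m^n disjoint cylinders have mass m^(-n) each, so almost surely every ball has a label in 1,
    ..., m. *)
Let full : P (~` \bigcup_z cylinder z) = 0%E.
Proof.
have mU : measurable (\bigcup_z cylinder z).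
  apply: countable_bigcupT_measurable => [|z]; first exact: countableP.
  exact: measurable_cylinder.
rewrite probability_setC//.
have -> : P (\bigcup_z cylinder z) = (\int[P]_w (step (fun=> 1) w)%:E)%E.
  transitivity (\int[P]_w (\1_(\bigcup_z cylinder z) w)%:E)%E.
    by rewrite integral_indic// setIT.
  apply: eq_integral => w _.
  congr EFin; rewrite indicE; case: (pselect ((\bigcup_z cylinder z) w)) => [[z _ zw]|Uw].
    by rewrite (stepE _ zw) mem_set//; exists z.
  rewrite memNset// /step big1// => z _.
  by rewrite indicE memNset ?mulr0// => zw; apply: Uw; exists z.
rewrite integral_step mean_cst ?subee//.
by rewrite card_ffun !card_ord expn_gt0 m_gt0.
Qed.

(** Off a null set the function agrees with the simple function [step a], whose integral is a finite
    sum. *)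
Lemma integral_config (phi : T -> R) (a : config -> R) : measurable_fun setT phi ->
  (forall z w, cylinder z w -> phi w = a z) -> (\int[P]_w (phi w)%:E)%E = (mean a)%:E.
Proof.
move=> mphi phiE; rewrite -integral_step; apply: ae_eq_integral => //.
- exact/measurable_EFinP.
- exact/measurable_EFinP/measurable_step.
- exists (~` \bigcup_z cylinder z); split=> //.
    apply: measurableC; apply: countable_bigcupT_measurable => [|z]; first exact: countableP.
    exact: measurable_cylinder.
  move=> w /= H [z _ zw]; apply: H => _.
  by rewrite (stepE _ zw) (phiE _ _ zw).
Qed.

Let Y : config -> R := @nonisolated R n m.

Lemma non_isolated_cylinder z w : cylinder z w -> non_isolated X w = Y z.
Proof.
move=> zw; rewrite /non_isolated /Y /nonisolated /nb_single natr_sum.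
have -> : \sum_u (cnt z u == 1%N)%:R = \sum_i (cnt z (z i) == 1%N)%:R :> R.
  rewrite (sum_balls (fun u => (cnt z u == 1%N)%:R)); apply: eq_bigr => u _.
  by case: eqVneq => [->|_]; rewrite ?mulr0 ?mulr1.
have -> : n%:R = \sum_(i < n) 1 :> R by rewrite sumr_const card_ord.
rewrite -sumrB; apply: eq_bigr => i _; rewrite /urn_mates.
have -> : (\sum_(j < n) (X j w == X i w))%N = cnt z (z i).
  by apply: eq_bigr => j _; rewrite !zw eqSS.
(* Ball i counts itself, so the predecessor in [urn_mates] is a true subtraction. *)
have : (0 < cnt z (z i))%N by rewrite /cnt (bigD1 i)//= eqxx.
by case: (cnt z (z i)) => [|[|k]]//= _; rewrite ?subrr ?subr0.
Qed.

Let mY : measurable_fun setT (non_isolated X : T -> R).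
Proof. exact: measurable_funPT. Qed.

Lemma expectation_non_isolated : ('E_P[non_isolated X] = (mean Y)%:E)%E.
Proof. by rewrite unlock; apply: integral_config => // z w; exact: non_isolated_cylinder. Qed.

Lemma variance_non_isolated :
  ('V_P[non_isolated X] = (mean (fun z => (Y z - mean Y) ^+ 2))%:E)%E.
Proof.
rewrite /variance covariance.unlock expectation_non_isolated/= expectation.unlock.
apply: integral_config => [|z w zw].
  by apply: measurable_funM; apply: measurable_funB.
by rewrite /= !fctE/= (non_isolated_cylinder zw) expr2.
Qed.

Lemma kolmogorov_non_isolated_le K :
  (forall t, `|mean (fun z => ((Y z - mean Y)
      / Num.sqrt (mean (fun z => (Y z - mean Y) ^+ 2)) <= t)%R%:R) - std_cdf t| <= K) ->
  kolmogorov_normal P (non_isolated X) <= K.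
Proof.
move=> HK; rewrite /kolmogorov_normal expectation_non_isolated variance_non_isolated/=.
set mu := mean Y; set sg := Num.sqrt _.
apply: ge_sup; first by eexists; exists 0.
move=> _ [t _ <-].
have -> : P [set w | (non_isolated X w - mu) / sg <= t] =
    (mean (fun z => ((Y z - mu) / sg <= t)%R%:R))%:E.
  have mB : measurable [set w | (non_isolated X w - mu) / sg <= t].
    rewrite -[X in measurable X]setTI.
    apply: (@measurable_fun_le _ _ _ _ (fun w => (non_isolated X w - mu) / sg) (cst t)) => //.
    by apply: measurable_funM => //; apply: measurable_funB.
  transitivity (\int[P]_w (\1_[set w | ((non_isolated X w : R) - mu) / sg <= t] w)%:E)%E.
    by rewrite integral_indic// setIT.
  apply: integral_config.
    exact: measurable_indic.
  move=> z w zw; rewrite indicE -(non_isolated_cylinder zw).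
  case: (leP ((non_isolated X w - mu) / sg) t) => h; first by rewrite mem_set.
  by rewrite memNset//=; apply/negP; rewrite -ltNge.
exact: HK.
Qed.

End Transfer.

(** * Asymptotics *)

Section VarianceBound.
Variable R : realType.

Lemma bernoulli_ineq (x : R) k : 0 <= x <= 1 -> 1 - k%:R * x <= (1 - x) ^+ k.
Proof.
move=> /andP[x0 x1]; elim: k => [|k IH]; first by rewrite mul0r subr0.
rewrite exprS -natr1; apply: le_trans (_ : _ <= (1 - x) * (1 - k%:R * x)) _.
  by have : 0 <= k%:R * x * x; [rewrite !mulr_ge0|lra].
by rewrite ler_wpM2l// subr_ge0.
Qed.

(** Lower bound for the variance per ball, written as a function of t, a and r, which is continuous
    at their limits 0, alpha and exp(- alpha). *)
Definition var_rate (n m : nat) : R :=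
  let t := m%:R^-1 in let a := n%:R / m%:R in let r := (1 - t) ^+ n.-2 in
  (1 - t) * r + r ^+ 2 * (1 - t) * (a - 1 - (a - t) * (a - 2 * t) / (1 - t) ^+ 2).

(* With [t = 1/m], [1 - 2 t = (1 - t)^2 (1 - y)] for [y = t^2 / (1 - t)^2];
   Bernoulli's inequality for [(1 - y)^(n - 2)] isolates the cancellation of the
   leading terms. *)
Lemma variance_nonisolated_ge n m : (4 <= m)%N -> (2 <= n)%N ->
  n%:R * var_rate n m <=
  mean (fun x => (@nonisolated R n m x - mean (@nonisolated R n m)) ^+ 2).
Proof.
move=> m4 n2.
have m_gt0 : (0 < m)%N by apply: leq_trans m4.
have T0 : (0 < #|{: {ffun 'I_n -> 'I_m}}|)%N.
  by rewrite card_ffun !card_ord expn_gt0 m_gt0.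
pose mN := mean (@nb_single R n m).
have -> : mean (fun x => (@nonisolated R n m x - mean (@nonisolated R n m)) ^+ 2) =
    mean (fun x => @nb_single R n m x ^+ 2) - mN ^+ 2.
  have -> : mean (@nonisolated R n m) = n%:R - mN.
    by rewrite /nonisolated meanB mean_cst.
  have -> : mN ^+ 2 = 2 * mN * mN - mN ^+ 2 by ring.
  rewrite {3}/mN -[X in _ - (_ - X)](mean_cst _ T0) -meanZ -!meanB.
  by apply: eq_mean => x; rewrite /nonisolated; ring.
rewrite mean_sqr_singletons// /mN mean_singletons//.
have mR : 4 <= m%:R :> R by rewrite ler_nat.
rewrite /var_rate; set t : R := m%:R^-1.
have t0 : 0 < t by rewrite invr_gt0; lra.
have t1 : t <= 4^-1 by rewrite lef_pV2 ?posrE//; lra.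
have mt : m%:R = t^-1 :> R by rewrite invrK.
(* From here on k = n - 2 and a = (k + 2) t. *)
case: n n2 T0 mN => [|[|k]]// _ _ _; rewrite /=.
set r := (1 - t) ^+ k.
pose y := t ^+ 2 / (1 - t) ^+ 2.
have t1' : 0 < (1 - t) ^+ 2 by rewrite exprn_gt0//; lra.
have y01 : 0 <= y <= 1.
  rewrite divr_ge0 ?sqr_ge0//= ler_pdivrMr// mul1r lerXn2r ?nnegrE//; lra.
have E : (1 - 2 * t) ^+ k = r ^+ 2 * (1 - y) ^+ k.
  rewrite /r exprAC -exprMn; congr (_ ^+ k); rewrite /y; field.
  by rewrite gt_eqF//; lra.
have B := bernoulli_ineq k y01.
rewrite E [(1 - t) ^+ k.+1]exprS -/r natrM.
have r0 : 0 <= r ^+ 2 by exact: sqr_ge0.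
have kn0 : 0 <= k.+2%:R * k.+1%:R * (1 - t) * r ^+ 2.
  by rewrite -natrM mulr_ge0// mulr_ge0//; lra.
have : k.+2%:R * k.+1%:R * (1 - t) * (r ^+ 2 * (1 - k%:R * y)) <=
    k.+2%:R * k.+1%:R * (1 - t) * (r ^+ 2 * (1 - y) ^+ k).
  by rewrite !(mulrA _ (r ^+ 2)); exact: ler_wpM2l.
set A := k.+2%:R * k.+1%:R * (1 - t) * (r ^+ 2 * (1 - y) ^+ k).
suff -> : k.+2%:R * ((1 - t) * r + r ^+ 2 * (1 - t) *
    (k.+2%:R * t - 1 - (k.+2%:R * t - t) * (k.+2%:R * t - 2 * t) / (1 - t) ^+ 2)) =
    k.+2%:R * ((1 - t) * r) + k.+2%:R * k.+1%:R * (1 - t) * (r ^+ 2 * (1 - k%:R * y))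
    - (k.+2%:R * ((1 - t) * r)) ^+ 2 by lra.
rewrite /y -!(natr1 k.+1) -!(natr1 k); field.
by rewrite gt_eqF//; lra.
Qed.

End VarianceBound.

(** * Positivity of the limiting variance *)

Section GPositive.
Variables (R : realType) (a : R).
Hypothesis a_gt0 : 0 < a.

Lemma g_sqr_gt0 : 0 < expR (- a) - expR (- 2 * a) * (a ^+ 2 - a + 1).
Proof.
have E0 := expR_gt0 (- a).
have EE : expR (- a) * expR a = 1 by rewrite -expRD addrC subrr expR0.
have -> : expR (- 2 * a) = expR (- a) ^+ 2.
  by rewrite -expRM_natl; congr expR; ring.
have lt : a ^+ 2 - a + 1 < expR a.
  (* After division by exp(- 2 a) the claim is a^2 - a + 1 < exp(a), and exp(a) is the fourth power
     of exp(a / 4) >= 1 + a / 4. *)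
  apply: (@lt_le_trans _ _ ((1 + a / 4) ^+ 4)).
    have -> : (1 + a / 4) ^+ 4 = a ^+ 2 - a + 1 +
        a * (2 - 5 / 8 * a + a ^+ 2 / 16) + a ^+ 4 / 256 by field.
    have : 0 < a * (2 - 5 / 8 * a + a ^+ 2 / 16).
      (* The quadratic factor is ((a - 5)^2 + 7) / 16. *)
      rewrite mulr_gt0//; have := sqr_ge0 (a - 5); rewrite !expr2; lra.
    have : 0 <= a ^+ 4 by rewrite exprn_ge0// ltW.
    lra.
  have -> : expR a = expR (a / 4) ^+ 4.
    by rewrite -expRM_natl; congr expR; field.
  rewrite lerXn2r ?nnegrE ?expR_ge0 ?expR_ge1Dx//.
  by rewrite addr_ge0// divr_ge0// ltW.
have -> : expR (- a) - expR (- a) ^+ 2 * (a ^+ 2 - a + 1) =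
   expR (- a) ^+ 2 * (expR a - (a ^+ 2 - a + 1)).
  by rewrite mulrBr; congr (_ - _); rewrite expr2 -mulrA EE mulr1.
by rewrite mulr_gt0 ?exprn_gt0// subr_gt0.
Qed.

Lemma g_gt0 : 0 < g a.
Proof. by rewrite sqrtr_gt0 g_sqr_gt0. Qed.

Lemma g_sqrE : g a ^+ 2 = expR (- a) - expR (- 2 * a) * (a ^+ 2 - a + 1).
Proof. by rewrite sqr_sqrtr// ltW// g_sqr_gt0. Qed.

End GPositive.

(** * Limits of the variance bound and of the weights *)

Section Limits.
Variables (R : realType) (alpha : R) (m : nat -> nat).
Hypotheses (m_ge4 : forall n, (4 <= m n)%N) (m_cvg : m n @[n --> \oo] --> \oo).
Hypothesis ratio_cvg : (n%:R / (m n)%:R : R) @[n --> \oo] --> alpha.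

Let t n : R := (m n)%:R^-1.

Let t01 n : 0 < t n <= 4^-1.
Proof.
have m4 : 4 <= (m n)%:R :> R by rewrite ler_nat.
rewrite /t invr_gt0 lef_pV2 ?posrE//; last lra.
by rewrite m4 andbT; lra.
Qed.

Let t_cvg : t n @[n --> \oo] --> (0 : R).
Proof.
apply/(gtr0_cvgV0 (f := fun n => (m n)%:R)).
  by near=> n; rewrite ltr0n (leq_trans _ (m_ge4 n)).
exact: (@cvg_comp _ _ _ m (fun k : nat => k%:R : R) _ _ _ m_cvg (@cvgr_idn R)).
Unshelve. all: by end_near. Qed.

Let q_cvg : (1 - t n) @[n --> \oo] --> (1 : R).
Proof.
rewrite -[X in _ --> X]subr0.
by apply: cvgB; [exact: cvg_cst|exact: t_cvg].
Qed.

Let k_cvg : (n.-2%:R * t n) @[n --> \oo] --> alpha.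
Proof.
have lim : (fun n => n%:R / (m n)%:R - 2 * t n) n @[n --> \oo] --> alpha.
  rewrite -[alpha]subr0 -[X in _ - X](mulr0 2).
  by apply: cvgB => //; apply: cvgM; [exact: cvg_cst|exact: t_cvg].
apply: cvg_trans lim; apply: near_eq_cvg; near=> n.
have n2 : (2 <= n)%N by near: n; exact: nbhs_infty_ge.
by rewrite -/(t n) -[X in X%:R * _ - _](subnK n2) natrD subn2; ring.
Unshelve. all: by end_near. Qed.

(** Squeezing: exp(- t / (1 - t)) <= 1 - t <= exp(- t), raised to the power n - 2; both exponents
    tend to - alpha. *)
Let r_cvg : ((1 - t n) ^+ n.-2) @[n --> \oo] --> expR (- alpha).
Proof.
have up : expR (- (n.-2%:R * t n)) @[n --> \oo] --> expR (- alpha).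
  apply: (@cvg_comp _ _ _ (fun n => - (n.-2%:R * t n)) expR _ _ _ _ (@continuous_expR R _)).
  by apply: cvgN; exact: k_cvg.
have lo : expR (- (n.-2%:R * t n * (1 - t n)^-1)) @[n --> \oo] --> expR (- alpha).
  apply: (@cvg_comp _ _ _ (fun n => - (n.-2%:R * t n * (1 - t n)^-1)) expR _ _ _ _
    (@continuous_expR R _)).
  have := cvgM k_cvg (cvgV (oner_neq0 _) q_cvg).
  rewrite invr1 mulr1 => h; by apply: cvgN; exact: h.
apply: (squeeze_cvgr _ lo up); near=> n.
have /andP[t0 t4] := t01 n.
have q0 : 0 < 1 - t n by lra.
apply/andP; split.
  have -> : - (n.-2%:R * t n * (1 - t n)^-1) = n.-2%:R * (- (t n / (1 - t n))) by ring.
  rewrite expRM_natl lerXn2r ?nnegrE ?expR_ge0 ?(ltW q0)//.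
  rewrite expRN -[leRHS]invrK lef_pV2 ?posrE ?expR_gt0 ?invr_gt0//.
  apply: le_trans (expR_ge1Dx _).
  by rewrite le_eqVlt; apply/orP; left; apply/eqP; field; rewrite gt_eqF.
rewrite -mulrN expRM_natl lerXn2r ?nnegrE ?expR_ge0 ?(ltW q0)//.
by apply: le_trans (expR_ge1Dx _).
Unshelve. all: by end_near. Qed.

Lemma var_rate_cvg : var_rate R n (m n) @[n --> \oo] -->
  expR (- alpha) - expR (- 2 * alpha) * (alpha ^+ 2 - alpha + 1).
Proof.
(* The limit is put into the shape of [var_rate] with t = 0, so that it can be matched factor by
   factor. *)
have -> : expR (- alpha) - expR (- 2 * alpha) * (alpha ^+ 2 - alpha + 1) =
   1 * expR (- alpha) + expR (- alpha) * expR (- alpha) * 1 *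
     (alpha - 1 - (alpha - 0) * (alpha - 2 * 0) * (1 * 1)^-1).
  have -> : expR (- 2 * alpha) = expR (- alpha) * expR (- alpha).
    by rewrite -expRD; congr expR; ring.
  by rewrite !mulr1 invr1; ring.
rewrite /var_rate /=.
apply: cvgD; first by apply: cvgM; [exact: q_cvg|exact: r_cvg].
apply: cvgM.
  apply: cvgM; last exact: q_cvg.
  by under eq_fun do rewrite expr2; apply: cvgM; exact: r_cvg.
apply: cvgB; first by apply: cvgB => //; exact: cvg_cst.
apply: cvgM.
  apply: cvgM; first by apply: cvgB => //; exact: t_cvg.
  by apply: cvgB => //; apply: cvgM; [exact: cvg_cst|exact: t_cvg].
apply: cvgV; first by rewrite mulr1 oner_neq0.
by under eq_fun do rewrite expr2; apply: cvgM; exact: q_cvg.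
Qed.

(** This is n times the top weight, as a ball is isolated with probability (1 - t)^(n - 1). *)
Lemma occupied_rate_cvg :
  (n%:R / (n%:R - 1) * (1 - (1 - t n) ^+ n.-1)) @[n --> \oo] --> 1 - expR (- alpha).
Proof.
have inv_cvg : (n%:R^-1 : R) @[n --> \oo] --> (0 : R).
  apply/(gtr0_cvgV0 (f := fun n => n%:R)); last exact: cvgr_idn.
  by near=> n; rewrite ltr0n; near: n; exact: nbhs_infty_gt.
have lim : ((1 - n%:R^-1)^-1 * (1 - (1 - t n) * (1 - t n) ^+ n.-2)) @[n --> \oo] -->
    (1 - 0)^-1 * (1 - 1 * expR (- alpha)).
  apply: cvgM.
    apply: cvgV; first by rewrite subr0 oner_neq0.
    by apply: cvgB => //; exact: cvg_cst.
  apply: cvgB; first exact: cvg_cst.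
  by apply: cvgM; [exact: q_cvg|exact: r_cvg].
rewrite subr0 invr1 !mul1r in lim.
apply: cvg_trans lim; apply: near_eq_cvg; near=> n.
have n2 : (2 <= n)%N by near: n; exact: nbhs_infty_ge.
rewrite -exprS; rewrite prednK; last by rewrite -subn1 subn_gt0.
congr (_ * _); have n1 : 2 <= n%:R :> R by rewrite ler_nat.
by field; rewrite !gt_eqF//; lra.
Unshelve. all: by end_near. Qed.

End Limits.

(** * The limit superior of the scaled distance *)

Lemma limn_esup_le_near (R : realType) (u : nat -> \bar R) (c : \bar R) :
  (\forall n \near \oo, (u n <= c)%E) -> (limn_esup u <= c)%E.
Proof.
move=> [N _ uN]; rewrite limn_esup_lim; apply: lime_le; first exact: is_cvg_esups.
exists N => // n /= Nn; apply: ge_ereal_sup => _ [k /= nk <-].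
by apply: uN => /=; exact: leq_trans nk.
Qed.

(** Both terms decrease in s, and at s = n v all powers of n cancel. *)
Lemma scaled_bound (R : realType) (n : nat) (L s v : R) : (0 < n)%N -> 0 <= L -> 0 < v ->
  n%:R * v <= s ->
  Num.sqrt n%:R * (112 * n%:R * L / (s * Num.sqrt s) + 40 * Num.sqrt n%:R * L / s)
  <= 112 * L / (v * Num.sqrt v) + 40 * L / v.
Proof.
move=> n0 L0 v0 nvs; have nR : 0 < n%:R :> R by rewrite ltr0n.
have s0 : 0 < s by apply: lt_le_trans nvs; rewrite mulr_gt0.
have rn : 0 < Num.sqrt n%:R :> R by rewrite sqrtr_gt0.
have rv : 0 < Num.sqrt v by rewrite sqrtr_gt0.
have rs : 0 < Num.sqrt s by rewrite sqrtr_gt0.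
have nn : Num.sqrt n%:R * Num.sqrt n%:R = n%:R :> R by rewrite -expr2 sqr_sqrtr// ltW.
have rnv : Num.sqrt n%:R * Num.sqrt v <= Num.sqrt s.
  by rewrite -sqrtrM ?ler_sqrt// ltW.
rewrite mulrDr; apply: lerD.
  have -> : Num.sqrt n%:R * (112 * n%:R * L / (s * Num.sqrt s)) =
      112 * L * (n%:R * Num.sqrt n%:R / (s * Num.sqrt s)) by ring.
  rewrite ler_wpM2l ?mulr_ge0// ler_pdivrMr ?mulr_gt0//.
  have -> : (v * Num.sqrt v)^-1 * (s * Num.sqrt s) = (s * Num.sqrt s) / (v * Num.sqrt v).
    by rewrite mulrC.
  rewrite ler_pdivlMr ?mulr_gt0// mulrACA.
  by apply: ler_pM => //; rewrite mulr_ge0// ltW.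
have -> : Num.sqrt n%:R * (40 * Num.sqrt n%:R * L / s) =
    40 * L * (Num.sqrt n%:R * Num.sqrt n%:R / s) by ring.
by rewrite nn ler_wpM2l ?mulr_ge0// ler_pdivrMr// mulrC ler_pdivlMr.
Qed.

Theorem theorem2 (R : realType) (alpha : R) (m : nat -> nat)
    (d : nat -> measure_display) (T : forall n : nat, measurableType (d n))
    (P : forall n : nat, probability (T n) R)
    (X : forall n : nat, 'I_n -> {RV (P n) >-> nat})
    (alpha_gt0 : 0 < alpha)
    (m_ge4 : forall n : nat, (4 <= m n)%N)
    (m_cvg : m n @[n --> \oo] --> \oo)
    (ratio_cvg : (n%:R / (m n)%:R : R) @[n --> \oo] --> alpha)
    (X_indep : forall n : nat, mutually_independent (X n))
    (X_unif : forall (n : nat) (i : 'I_n), uniform_on_range (m n) (X n i)) :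
  0 < g alpha /\
  (limn_esup (fun n : nat =>
     (Num.sqrt n%:R * kolmogorov_normal (P n) (non_isolated (X n)))%:E)
   <= (8 / 10 / g alpha
       + 256 * ((1 - expR (- alpha)) / g alpha ^+ 3)
       + 92 * ((1 - expR (- alpha)) / g alpha ^+ 2)
            * Num.sqrt (1 + 3 * alpha * (1 + alpha)))%:E)%E.
Proof.
have g0 := g_gt0 alpha_gt0; split=> //.
have v_cvg := var_rate_cvg m_ge4 m_cvg ratio_cvg; rewrite -g_sqrE// in v_cvg.
have L_cvg := occupied_rate_cvg m_ge4 m_cvg ratio_cvg.
set E := 1 - expR (- alpha) in L_cvg *.
set ta := _ + _ + _.
pose v n := var_rate R n (m n); pose t n : R := (m n)%:R^-1.
pose L n : R := n%:R / (n%:R - 1) * (1 - (1 - t n) ^+ n.-1).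
have U_cvg : (112 * L n / (v n * Num.sqrt (v n)) + 40 * L n / v n) @[n --> \oo] -->
    112 * E / (g alpha ^+ 2 * g alpha) + 40 * E / g alpha ^+ 2.
  have g2 : g alpha ^+ 2 != 0 by rewrite gt_eqF// exprn_gt0.
  have sv : Num.sqrt (v n) @[n --> \oo] --> g alpha.
    rewrite -[X in _ --> X](gtr0_norm g0) -sqrtr_sqr.
    exact: (@cvg_comp _ _ _ v (@Num.sqrt R) _ _ _ v_cvg (@sqrt_continuous R _)).
  apply: cvgD.
    apply: cvgM; first by apply: cvgM; [exact: cvg_cst|exact: L_cvg].
    apply: cvgV; first by rewrite mulf_neq0// gt_eqF.
    by apply: cvgM; [exact: v_cvg|exact: sv].
  apply: cvgM; first by apply: cvgM; [exact: cvg_cst|exact: L_cvg].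
  by apply: cvgV => //; exact: v_cvg.
have E0 : 0 < E by rewrite subr_gt0 -expR0 ltr_expR oppr_lt0.
(* Since 112 < 256, 40 < 92, the square root is at least 1 and 0.8 / g is positive, the limit lies
   strictly below the target; so the bound itself is eventually below it. *)
have U_lt : 112 * E / (g alpha ^+ 2 * g alpha) + 40 * E / g alpha ^+ 2 < ta.
  have sq1 : 1 <= Num.sqrt (1 + 3 * alpha * (1 + alpha)).
    rewrite -[leLHS]sqrtr1 ler_sqrt; last first.
      by rewrite addr_ge0// !mulr_ge0// ltW// addr_gt0.
    by rewrite lerDl !mulr_ge0// ltW// addr_gt0.
  have -> : g alpha ^+ 2 * g alpha = g alpha ^+ 3 by rewrite [RHS]exprSr.
  rewrite /ta -!mulrA.
  have h1 : 0 < E * (g alpha ^+ 3)^-1 by rewrite divr_gt0// exprn_gt0.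
  have h2 : 0 < E * (g alpha ^+ 2)^-1 by rewrite divr_gt0// exprn_gt0.
  have h3 : 0 < (g alpha)^-1 by rewrite invr_gt0.
  have h4 : E * (g alpha ^+ 2)^-1 <= E * ((g alpha ^+ 2)^-1 *
      Num.sqrt (1 + 3 * (alpha * (1 + alpha)))).
    rewrite -mulrA in sq1; rewrite [leRHS]mulrA.
    by apply: ler_peMr => //; exact: ltW.
  lra.
(* The limit g(alpha)^2 is positive, so the lower bound for the variance is eventually positive. *)
have v_pos : \forall n \near \oo, 0 < v n.
  by apply: (@cvgr_gt R nat \oo _ v _ v_cvg 0); rewrite exprn_gt0.
have U_near : \forall n \near \oo,
    112 * L n / (v n * Num.sqrt (v n)) + 40 * L n / v n <= ta.
  exact: (@cvgr_le R nat \oo _ _ _ U_cvg ta U_lt).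
apply: limn_esup_le_near; near=> n; rewrite lee_fin.
have v0 : 0 < v n by near: n.
have n2 : (2 <= n)%N by near: n; exact: nbhs_infty_ge.
apply: (@le_trans _ _ (112 * L n / (v n * Num.sqrt (v n)) + 40 * L n / v n)); last first.
  by near: n.
have m4 := m_ge4 n; have n_gt0 : (0 < n)%N by apply: leq_trans n2.
have m2 : (2 <= m n)%N by apply: leq_trans m4.
have m1 : (0 < m n)%N by apply: leq_trans m4.
have nR : 0 < n%:R :> R by rewrite ltr0n.
pose s := mean (fun x => (@nonisolated R n (m n) x - mean (@nonisolated R n (m n))) ^+ 2).
have vs : n%:R * v n <= s by exact: variance_nonisolated_ge.
have s0 : 0 < s by apply: lt_le_trans vs; rewrite mulr_gt0.
have t01 : 0 < 1 - t n < 1.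
  have mR : 4 <= (m n)%:R :> R by rewrite ler_nat.
  rewrite subr_gt0 ltrBlDr ltrDl invr_gt0 invf_lt1; last by lra.
  by apply/andP; split; lra.
have /andP[q0 q1] := t01.
have bE : mean (@nb_single R n (m n)) / n%:R = (1 - t n) ^+ n.-1.
  by rewrite mean_singletons// mulrC mulKf// gt_eqF.
have L0 : 0 <= L n.
  have n1 : 2 <= n%:R :> R by rewrite ler_nat.
  rewrite mulr_ge0//; first by rewrite divr_ge0//; lra.
  by rewrite subr_ge0 exprn_ile1// ltW.
apply: le_trans (scaled_bound n_gt0 L0 v0 vs).
rewrite ler_wpM2l ?sqrtr_ge0//.
apply: (kolmogorov_non_isolated_le m1 (X_indep n) (X_unif n)) => u.
have := @nonisolated_berry_esseen R n (m n) m2 n2 _ s0 u.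
by rewrite bE; apply; rewrite exprn_gt0.
Unshelve. all: by end_near. Qed.
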